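(* Let $N\in\mathbb{N}$. For every $k\in\mathbb{N}$ (with $k\ge1$) and every $\alpha\in(k,\infty)$ we have $$(-1)^k\,\mathrm{div}_k\left(|x|^{2\alpha-N}\,\nabla^k\left(\frac{1}{|x|^{\alpha-k}}\right)\right)=\frac{\lambda_N^{k-\alpha,k}}{|x|^{N-\alpha+k}}$$ in the sense of distributions on $\mathbb{R}^N$.
   Context: $\nabla^k v(x)$ denotes the tensor of all $N^k$ partial derivatives $\frac{\partial^k v}{\partial x_{i_1}\cdots\partial x_{i_k}}(x)$, $i_1,\ldots,i_k\in\{1,\ldots,N\}$, and $|\nabla^k v|(x)$ is its Euclidean norm in $\mathbb{R}^{N^k}$. In the statement $\nabla^k(|x|^{-(\alpha-k)})$ is the pointwise derivative on $\mathbb{R}^N\setminus\{0\}$, so that $|x|^{2\alpha-N}\nabla^k(|x|^{-(\alpha-k)})$ is a locally integrable tensor field on $\mathbb{R}^N$. For a tensor $T=(T_{i_1,\ldots,i_k})$ with $N^k$ components, $\mathrm{div}_k(T)=\sum_{i_1,\ldots,i_k\in\{1,\ldots,N\}}\frac{\partial^kT_{i_1,\ldots,i_k}}{\partial x_{i_1}\cdots\partial x_{i_k}}$. For an integer $k\ge1$ and $s\in\mathbb{R}$, $\lambda_N^{s,k}$ is the constant (depending only on $N,s,k$) such that $\big|\nabla^k|x|^s\big|^2=\lambda_N^{s,k}\,|x|^{-2(k-s)}$ for all $x\in\mathbb{R}^N\setminus\{0\}$ (such a constant exists; it is positive for $s<0$). *)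

(* Defs.v *)
From HB Require Import structures.
From mathcomp Require Import all_boot all_order all_algebra.
From mathcomp Require Import all_classical all_reals all_analysis.
Import Order.TTheory GRing.Theory Num.Theory.
Import numFieldNormedType.Exports.

Set Implicit Arguments.
Unset Strict Implicit.
Unset Printing Implicit Defensive.

Local Open Scope classical_set_scope.
Local Open Scope ring_scope.

(** R^n is ['rV[R]_n], with the product sigma-algebra (generated by the
    coordinates, as the library does for tuples).  It coincides with the Borel
    sigma-algebra of the topology of ['rV[R]_n]. *)

Definition rV_display : measure_display. Proof. exact. Qed.

Section measurable_rV.
Variables (R : realType) (n : nat).

Definition rV_coord (i : 'I_n) (x : 'rV[R]_n) : measurableTypeR R := x 0 i.

Let rV_set0 : g_sigma_preimage rV_coord set0.
Proof. exact: sigma_algebra0. Qed.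

Let rV_setC A : g_sigma_preimage rV_coord A -> g_sigma_preimage rV_coord (~` A).
Proof. exact: sigma_algebraC. Qed.

Let rV_bigcup (F : (set 'rV[R]_n)^nat) :
  (forall i, g_sigma_preimage rV_coord (F i)) ->
  g_sigma_preimage rV_coord (\bigcup_i (F i)).
Proof. exact: sigma_algebra_bigcup. Qed.

HB.instance Definition _ := @isMeasurable.Build rV_display
  'rV[R]_n (g_sigma_preimage rV_coord) rV_set0 rV_setC rV_bigcup.

End measurable_rV.

Lemma measurable_rV_coord (R : realType) n (i : 'I_n) :
  measurable_fun [set: 'rV[R]_n] (rV_coord i).
Proof.
move=> _ Y mY; rewrite setTI; apply: sub_sigma_algebra => /=.
rewrite -bigcup_seq/=; exists i => /=; first by rewrite mem_index_enum.
by exists Y => //; rewrite setTI.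
Qed.

Lemma measurable_fun_rVP d (T : measurableType d) (R : realType) n
    (f : T -> 'rV[R]_n) :
  (forall i, measurable_fun [set: T] (rV_coord i \o f)) ->
  measurable_fun [set: T] f.
Proof.
move=> mf _ A mA; rewrite setTI.
have : <<s \big[setU/set0]_(i < n)
    preimage_set_system setT (@rV_coord R n i) measurable >> A by exact: mA.
apply: (@smallest_sub _ _ _ [set B | measurable (f @^-1` B)]).
  split=> /=.
  - by rewrite preimage_set0.
  - by move=> B mB; rewrite setTD preimage_setC; exact: measurableC.
  - by move=> F mF; rewrite preimage_bigcup; exact: bigcup_measurable.
rewrite -bigcup_seq => B [i _ [Y mY <-]] /=.
by rewrite setTI -comp_preimage -[X in measurable X]setTI; exact: mf.
Qed.

Section rV_cons.
Variables (R : realType) (n : nat).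

Definition rV_cons (p : measurableTypeR R * 'rV[R]_n) : 'rV[R]_n.+1 :=
  \row_i oapp (fun j => p.2 0 j) p.1 (unlift 0 i).

Lemma measurable_rV_cons : measurable_fun setT rV_cons.
Proof.
apply: measurable_fun_rVP => i.
have [->|[j ->]] : i = 0 \/ exists j, i = lift 0 j.
  by case: (unliftP 0 i) => [j ->|->]; [right; exists j|left].
- rewrite (_ : _ \o _ = fst) //.
  by apply/funext => p; rewrite /rV_coord /= mxE unlift_none.
- rewrite (_ : _ \o _ = rV_coord j \o snd).
    by apply: measurableT_comp; [exact: measurable_rV_coord|exact: measurable_snd].
  by apply/funext => p; rewrite /rV_coord /= mxE liftK.
Qed.

Definition rV_uncons (x : 'rV[R]_n.+1) : measurableTypeR R * 'rV[R]_n :=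
  (x 0 0, \row_j x 0 (lift 0 j)).

Lemma rV_consK : cancel rV_cons rV_uncons.
Proof.
move=> [a y]; rewrite /rV_uncons mxE unlift_none /=; congr pair.
by apply/rowP => j; rewrite !mxE liftK.
Qed.

Lemma measurable_rV_uncons : measurable_fun setT rV_uncons.
Proof.
apply: measurable_fun_pair; first exact: measurable_rV_coord.
apply: measurable_fun_rVP => i; rewrite (_ : _ \o _ = rV_coord (lift 0 i)).
  exact: measurable_rV_coord.
by apply/funext => x; rewrite /rV_coord /= mxE.
Qed.

End rV_cons.

Lemma sigma_finite_product d1 d2 (T1 : measurableType d1)
    (T2 : measurableType d2) (R : realType)
    (m1 : {sigma_finite_measure set T1 -> \bar R})
    (m2 : {sigma_finite_measure set T2 -> \bar R}) :
  sigma_finite setT (m1 \x m2)%E.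
Proof.
have /sigma_finiteP[F [TF ndF Foo]] := sigma_finiteT m1.
have /sigma_finiteP[G [TG ndG Goo]] := sigma_finiteT m2.
exists (fun n => F n `*` G n).
  rewrite -setXTT TF TG predeqE => -[x y]; split=> [|[n _ []/= ? ?]].
    move=> [/= [n _ Fnx] [k _ Gky]]; exists (maxn n k) => //; split.
    - by move: x Fnx; exact/subsetPset/ndF/leq_maxl.
    - by move: y Gky; exact/subsetPset/ndG/leq_maxr.
  by split; exists n.
move=> k; have [? ?] := Foo k; have [? ?] := Goo k.
split; first exact: measurableX.
by rewrite product_measure1E// lte_mul_pinfty// ge0_fin_numE.
Qed.

Section lebesgue_rV_step.
Variables (R : realType) (n : nat).
Variable m : {sigma_finite_measure set 'rV[R]_n -> \bar R}.

Definition lebesgue_rV_step : set 'rV[R]_n.+1 -> \bar R :=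
  pushforward (lebesgue_measure \x m)%E (@rV_cons R n).

Let step0 : lebesgue_rV_step set0 = 0%E.
Proof. by rewrite /lebesgue_rV_step /pushforward preimage_set0 measure0. Qed.

Let step_ge0 A : (0 <= lebesgue_rV_step A)%E.
Proof. by rewrite /lebesgue_rV_step /pushforward; apply: measure_ge0. Qed.

Let step_sigma_additive : semi_sigma_additive lebesgue_rV_step.
Proof.
move=> F mF tF mUF; rewrite /lebesgue_rV_step /pushforward preimage_bigcup.
have mpre A : measurable A -> measurable (@rV_cons R n @^-1` A).
  by move=> mA; rewrite -[X in measurable X]setTI; exact: measurable_rV_cons.
apply: measure_semi_sigma_additive.
- by move=> i; exact: mpre.
- apply/trivIsetP => /= i j _ _ ij; rewrite -preimage_setI.
  by move/trivIsetP : tF => /(_ _ _ _ _ ij) ->//; rewrite preimage_set0.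
- by rewrite -preimage_bigcup; exact: mpre.
Qed.

HB.instance Definition _ := isMeasure.Build _ _ _
  lebesgue_rV_step step0 step_ge0 step_sigma_additive.

Let step_sigma_finite : sigma_finite setT lebesgue_rV_step.
Proof.
have [F FT mF] : sigma_finite setT (lebesgue_measure \x m)%E.
  exact: sigma_finite_product.
exists (fun i => @rV_uncons R n @^-1` F i).
  by rewrite -preimage_bigcup -FT preimage_setT.
move=> i; have [mFi Fi] := mF i; split.
  by rewrite -[X in measurable X]setTI; exact: measurable_rV_uncons.
rewrite /lebesgue_rV_step /pushforward -comp_preimage.
by rewrite (_ : _ \o _ = id) //; apply/funext => p /=; rewrite rV_consK.
Qed.

HB.instance Definition _ := Measure_isSigmaFinite.Build _ _ _
  lebesgue_rV_step step_sigma_finite.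

End lebesgue_rV_step.

Fixpoint lebesgue_rV (R : realType) (n : nat) :
    {sigma_finite_measure set 'rV[R]_n -> \bar R} :=
  match n with
  | 0 => \d_(0 : 'rV[R]_0)
  | n'.+1 => lebesgue_rV_step (lebesgue_rV R n')
  end.

Lemma lebesgue_rV_box (R : realType) n (A : 'I_n -> set (measurableTypeR R)) :
  (forall i, measurable (A i)) ->
  lebesgue_rV R n [set x : 'rV[R]_n | forall i, A i (x 0 i)] =
  (\prod_(i < n) lebesgue_measure (A i))%E.
Proof.
elim: n A => [|n IH] A mA.
  rewrite big_ord0 /= diracE mem_set //.
  by case.
rewrite big_ord_recl -IH //.
set B : set 'rV[R]_n := [set x : 'rV[R]_n | forall i, A (lift 0 i) (x 0 i)].
have mB : measurable B.
  rewrite (_ : B = \bigcap_(i in [set: 'I_n]) (rV_coord i @^-1` A (lift 0 i))).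
    apply: fin_bigcap_measurable => // i _.
    by rewrite -[X in measurable X]setTI; exact: measurable_rV_coord.
  by apply/seteqP; split => x /= h i; [move=> _; exact: h|exact: h].
rewrite -product_measure1E //= /lebesgue_rV_step /pushforward.
congr (_ _); apply/seteqP; split => -[a y] /=.
  move=> h; split => [|i]; first by have := h 0; rewrite mxE unlift_none.
  by have := h (lift 0 i); rewrite mxE liftK.
move=> [ha hy] i; rewrite mxE.
by case: (unliftP 0 i) => [j ->|->] //=; exact: hy.
Qed.

Section calculus.
Variables (R : realType) (N : nat).
Local Notation E := 'rV[R]_N.

(** The norm of the library on ['rV[R]_N] is the sup norm. *)
Definition enorm (x : E) : R := Num.sqrt (\sum_(i < N) x 0 i ^+ 2).

Definition partial (i : 'I_N) (f : E -> R) : E -> R :=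
  fun x => 'D_(delta_mx 0 i : E) f x.

(** [partials [:: i_1; ...; i_k] f] is d/dx_{i_1} ( ... (d/dx_{i_k} f)), so that
    [fun I : k.-tuple 'I_N => partials I f] is the tensor nabla^k f. *)
Definition partials (s : seq 'I_N) (f : E -> R) : E -> R := foldr partial f s.

Definition norm_nabla (k : nat) (f : E -> R) (x : E) : R :=
  Num.sqrt (\sum_(I : k.-tuple 'I_N) partials I f x ^+ 2).

(** The constant lambda_N^{s,k}.  For N > 0 and k > 0 exactly one constant
    satisfies the defining property, so the default value [0] of [xget] plays no
    role. *)
Definition lambda (s : R) (k : nat) : R :=
  xget 0 [set l : R | forall x : E, x != 0 ->
    norm_nabla k (fun y => enorm y `^ s) x ^+ 2 =
    l * enorm x `^ (- 2 * (k%:R - s))].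

Definition smooth (f : E -> R) : Prop :=
  forall s : seq 'I_N, continuous (partials s f) /\
    forall i x, derivable (partials s f) x (delta_mx 0 i : E).

Definition test_function (phi : E -> R) : Prop :=
  smooth phi /\ compact (closure [set x | phi x != 0]).

(** A distribution is represented by its values on test functions; its values
    on other functions are irrelevant, see [distr_eq]. *)
Definition distr := (E -> R) -> R.

Definition distr_eq (u v : distr) : Prop :=
  forall phi, test_function phi -> u phi = v phi.

Definition loc_integrable (f : E -> R) : Prop :=
  measurable_fun setT f /\
  forall K : set E, compact K ->
    (\int[lebesgue_rV R N]_(x in K) `|(f x)%:E| < +oo)%E.

Definition distr_of (f : E -> R) : distr :=
  fun phi => \int[lebesgue_rV R N]_x (f x * phi x).

Definition distr_partial (i : 'I_N) (u : distr) : distr :=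
  fun phi => - u (partial i phi).

Definition distr_partials (s : seq 'I_N) (u : distr) : distr :=
  foldr distr_partial u s.

Definition distr_div (k : nat) (T : k.-tuple 'I_N -> distr) : distr :=
  fun phi => \sum_(I : k.-tuple 'I_N) distr_partials I (T I) phi.

End calculus.

(* Main.v *)
(** Regularize: replace [|x|^2] by [rho e x = |x|^2 + e].  Every function in
    sight is a polynomial in the [x_i] and in real powers of [rho e], with
    coefficients that do not depend on [e], so it can be differentiated
    formally; for [e > 0] it is smooth and all integrations by parts are free.
    A homogeneous expression of degree [d] is bounded by [C (rho e)^(d/2)], so
    for [d > -N] dominated convergence gives the limit [e -> 0], and it only remains
    to compute away from the origin.

    There, [2 grad F . grad G = Lap(F G) - F Lap G - G Lap F] and
    [2 div(w grad G) = Lap(w G) + w Lap G - G Lap w] give, by induction on [k],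
    [Sum_I d_I r^a d_I r^b = b_k(a, b) r^(a+b-2k)] and
    [Sum_I d_I (r^m d_I r^a) = d_k(m, a) r^(m+a-2k)], with explicit recurrences
    for [b_k] and [d_k].  These recurrences coincide, up to the sign [(-1)^k],
    when [m + a + b = 2k - N]; the theorem is the case [m = 2 alpha - N],
    [a = b = k - alpha], where [b_k(a, a)] is [lambda]. *)

Require Import Defs.
From HB Require Import structures.
From mathcomp Require Import all_boot all_order all_algebra.
From mathcomp Require Import all_classical all_reals all_analysis.
From mathcomp Require Import measurable_realfun ring lra.
Import Order.TTheory GRing.Theory Num.Theory.
Import numFieldNormedType.Exports.

Set Implicit Arguments.
Unset Strict Implicit.
Unset Printing Implicit Defensive.

Local Open Scope classical_set_scope.
Local Open Scope ring_scope.

(** * Formal derivatives *)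

Section expr.
Variables (R : realType) (N : nat).
Local Notation E := 'rV[R]_N.

(* [Pow b] stands for [rho e x `^ b]: at [e = 0] this is the power [2b] of
   [|x|], so the exponents below are half of those of the header. *)
Inductive expr : Type :=
| Cst of R
| Var of 'I_N
| Pow of R
| Add of expr & expr
| Mul of expr & expr.

Definition rho (e : R) (x : E) : R := \sum_(i < N) x 0 i ^+ 2 + e.

Fixpoint eval (t : expr) (e : R) (x : E) : R :=
  match t with
  | Cst c => c
  | Var i => x 0 i
  | Pow b => rho e x `^ b
  | Add t u => eval t e x + eval u e x
  | Mul t u => eval t e x * eval u e x
  end.

Fixpoint deriv (i : 'I_N) (t : expr) : expr :=
  match t with
  | Cst _ => Cst 0
  | Var j => Cst (i == j)%:R
  | Pow b => Mul (Cst (2 * b)) (Mul (Var i) (Pow (b - 1)))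
  | Add t u => Add (deriv i t) (deriv i u)
  | Mul t u => Add (Mul (deriv i t) u) (Mul t (deriv i u))
  end.

Definition derivs (s : seq 'I_N) (t : expr) : expr := foldr deriv t s.

Lemma rho_ge0 e x : 0 <= e -> 0 <= rho e x.
Proof. by move=> e0; rewrite addr_ge0// sumr_ge0// => i _; rewrite sqr_ge0. Qed.

Lemma rho_gt0 e x : 0 < e -> 0 < rho e x.
Proof. by move=> e0; rewrite ltr_wpDl// sumr_ge0// => i _; rewrite sqr_ge0. Qed.

Lemma rho0_gt0 x : (0 < rho 0 x) = (x != 0).
Proof.
rewrite lt0r rho_ge0// andbT /rho addr0 psumr_eq0; last first.
  by move=> i _; rewrite sqr_ge0.
congr (~~ _); apply/idP/eqP => [/allP h|->]; last first.
  by apply/allP => i _; rewrite mxE expr0n eqxx.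
apply/rowP => i; have := h i (mem_index_enum _).
by rewrite mxE sqrf_eq0 => /eqP.
Qed.

Lemma derive_coord (i j : 'I_N) (x : E) :
  'D_(delta_mx 0 i : E) (fun y : E => y 0 j) x = (i == j)%:R.
Proof.
rewrite deriveE//; last exact: differentiable_coord.
have lf : linear (fun y : E => y 0 j : R^o) by move=> c y z; rewrite !mxE.
pose fM := GRing.isLinear.Build _ _ _ _ _ lf.
pose f : {linear E -> R^o} := HB.pack (fun y : E => y 0 j : R^o) fM.
rewrite (_ : (fun y : E => y 0 j) = f)// diff_lin; last exact: coord_continuous.
by rewrite /f /= mxE eqxx eq_sym.
Qed.

Let sqr_coordE i : (fun y : E => y 0 i ^+ 2) =
  (fun y : E => y 0 i) * (fun y : E => y 0 i).
Proof. by apply/funext => y; rewrite expr2. Qed.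

Let rhoE e : rho e = \sum_(i < N) (fun y : E => y 0 i ^+ 2) + cst e.
Proof. by apply/funext => y; rewrite /rho fctE fct_sumE. Qed.

Lemma differentiable_rho e x : differentiable (rho e) x.
Proof.
rewrite rhoE; apply: differentiableD; last exact: differentiable_cst.
apply: differentiable_sum => i.
by rewrite sqr_coordE; apply: differentiableM; exact: differentiable_coord.
Qed.

Lemma derive_rho e x i : 'D_(delta_mx 0 i : E) (rho e) x = 2 * x 0 i.
Proof.
have dx j : derivable (fun y : E => y 0 j) x (delta_mx 0 i).
  exact/diff_derivable/differentiable_coord.
have dX j : derivable (fun y : E => y 0 j ^+ 2) x (delta_mx 0 i).
  by rewrite sqr_coordE; exact: derivableM.
rewrite rhoE deriveD; last 2 first.
- by apply: derivable_sum => j; exact: dX.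
- exact: derivable_cst.
rewrite derive_cst addr0 derive_sum; last by move=> j; exact: dX.
rewrite (bigD1 i)//= big1 => [|j ji].
  by rewrite addr0 sqr_coordE deriveM// derive_coord eqxx /GRing.scale/=; ring.
by rewrite sqr_coordE deriveM// derive_coord eq_sym (negbTE ji) scaler0 addr0.
Qed.

(** The hypothesis covers both regimes in use: every [x] if [e > 0], and [x != 0] if [e = 0]. *)
Lemma differentiable_eval t e x : 0 < rho e x -> differentiable (eval t e) x.
Proof.
move=> x0; elim: t => [c|i|b|t IHt u IHu|t IHt u IHu] /=.
- exact: differentiable_cst.
- exact: differentiable_coord.
- apply: (@differentiable_comp _ _ _ _ (rho e) (@powR R ^~ b)).
    exact: differentiable_rho.
  by apply/derivable1_diffP; apply: ex_derive; exact: is_derive1_powR.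
- exact: differentiableD.
- exact: differentiableM.
Qed.

Lemma derive_eval t e x i : 0 < rho e x ->
  'D_(delta_mx 0 i : E) (eval t e) x = eval (deriv i t) e x.
Proof.
move=> x0; elim: t => [c|j|b|t IHt u IHu|t IHt u IHu] /=.
- exact: derive_cst.
- exact: derive_coord.
- have dp : differentiable (@powR R ^~ b : R -> R) (rho e x).
    by apply/derivable1_diffP; apply: ex_derive; exact: is_derive1_powR.
  rewrite (_ : (fun y => _) = (@powR R ^~ b) \o rho e)//.
  rewrite deriveE; last by apply: differentiable_comp => //; exact: differentiable_rho.
  rewrite diff_comp//=; last exact: differentiable_rho.
  have /(deriveE (delta_mx 0 i : E)) <- := differentiable_rho e x.
  (* By linearity, the differential of the power at the number [2 * x 0 i] is that number times the
     one-variable derivative. *)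
  rewrite derive_rho -[X in 'd _ _ X]mulr1 [LHS]linearZ/= -derive1E'//.
  by rewrite powR_derive1 ?in_itv/= ?x0// /GRing.scale/=; ring.
- rewrite (_ : (fun y => _) = eval t e + eval u e)//.
  by rewrite deriveD ?IHt ?IHu//; apply/diff_derivable/differentiable_eval.
- rewrite (_ : (fun y => _) = eval t e * eval u e)//.
  rewrite deriveM ?IHt ?IHu//; try by apply/diff_derivable/differentiable_eval.
  by rewrite addrC /GRing.scale/= mulrC.
Qed.

Lemma near_rho_gt0 e (x : E) : 0 < rho e x -> \forall y \near x, 0 < rho e y.
Proof.
move=> x0; have := differentiable_continuous (differentiable_rho e x).
by move=> /(_ _ (lt_nbhsr x0)).
Qed.

(** A derivative is local and [0 < rho e] is an open condition, so at [e = 0] the value of [f] at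
    the origin has no influence. *)
Lemma partial_eval (f : E -> R) t e : (forall x, 0 < rho e x -> f x = eval t e x) ->
  forall i x, 0 < rho e x -> partial i f x = eval (deriv i t) e x.
Proof.
move=> ft i x x0; rewrite -derive_eval//; apply: near_eq_derive.
by near=> y; apply: ft; near: y; exact: near_rho_gt0.
Unshelve. all: by end_near. Qed.

Lemma partials_eval (f : E -> R) t e :
  (forall x, 0 < rho e x -> f x = eval t e x) ->
  forall s x, 0 < rho e x -> partials s f x = eval (derivs s t) e x.
Proof. by move=> ft; elim=> [//|i s IH] /=; exact: partial_eval. Qed.

End expr.

(** * Identities away from the origin *)

Section identities.
Variables (R : realType) (N : nat).
Local Notation E := 'rV[R]_N.
Local Notation expr := (expr R N).
Implicit Types (t u w f g : expr) (s : seq 'I_N).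

Definition eqv t u := forall x, x != 0 -> eval t 0 x = eval u 0 x.

(** [deriv] acts on syntax, but by [partial_eval] it computes a true derivative, which depends only
    on the values near [x]. *)
Lemma eqv_deriv i t u : eqv t u -> eqv (deriv i t) (deriv i u).
Proof.
move=> tu x x0; rewrite -(@partial_eval _ _ (eval t 0))// ?rho0_gt0//.
by apply: partial_eval => [y|]; rewrite rho0_gt0//; exact: tu.
Qed.

Lemma eqv_derivs s t u : eqv t u -> eqv (derivs s t) (derivs s u).
Proof. by move=> tu; elim: s => [//|i s IH]; exact: eqv_deriv. Qed.

Lemma deriv_comm i j t e x :
  eval (deriv i (deriv j t)) e x = eval (deriv j (deriv i t)) e x.
Proof.
elim: t => [c|l|b|t IHt u IHu|t IHt u IHu] //=.
- by rewrite (eq_sym j i); ring.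
- by rewrite IHt IHu.
- by rewrite IHt IHu; ring.
Qed.

Lemma derivs_deriv s i t : eqv (derivs s (deriv i t)) (deriv i (derivs s t)).
Proof.
elim: s => [//|j s IH] x x0 /=.
by rewrite (eqv_deriv j IH)// deriv_comm.
Qed.

Lemma derivs_scale s c t :
  eqv (derivs s (Mul (Cst N c) t)) (Mul (Cst N c) (derivs s t)).
Proof.
elim: s => [//|j s IH] x x0 /=.
by rewrite (eqv_deriv j IH)//= mul0r add0r.
Qed.

Lemma derivs_Add s t u : derivs s (Add t u) = Add (derivs s t) (derivs s u).
Proof. by elim: s => [//|i s IH] /=; rewrite IH. Qed.

(** Sums are kept inside [expr] so that they can be differentiated formally in turn. *)
Definition addl (l : seq expr) : expr := foldr (@Add R N) (Cst N 0) l.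

Lemma eval_addl l e x : eval (addl l) e x = \sum_(t <- l) eval t e x.
Proof. by elim: l => [|t l IH] /=; rewrite ?big_nil// big_cons IH. Qed.

Lemma derivs_addl s l : derivs s (addl l) = addl (map (derivs s) l).
Proof.
elim: s l => [|i s IH] l /=; first by rewrite map_id.
rewrite IH; elim: l => [//|t l IHl] /=; congr Add; exact: IHl.
Qed.

Definition lap t := addl [seq deriv i (deriv i t) | i <- enum 'I_N].

Lemma eval_lap t e x : eval (lap t) e x = \sum_i eval (deriv i (deriv i t)) e x.
Proof. by rewrite eval_addl big_map big_enum. Qed.

Lemma eqv_lap t u : eqv t u -> eqv (lap t) (lap u).
Proof.
move=> tu x x0; rewrite !eval_lap; apply: eq_bigr => i _.
exact: (eqv_derivs [:: i; i] tu).
Qed.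

Lemma lap_addl l e x : eval (lap (addl l)) e x = \sum_(t <- l) eval (lap t) e x.
Proof.
under [RHS]eq_bigr do rewrite eval_lap.
rewrite eval_lap exchange_big/=; apply: eq_bigr => i _.
have -> : deriv i (deriv i (addl l)) = addl (map (derivs [:: i; i]) l).
  by rewrite -derivs_addl.
by rewrite eval_addl big_map.
Qed.

Lemma derivs_lap s t : eqv (derivs s (lap t)) (lap (derivs s t)).
Proof.
elim: s => [//|j s IH] x x0 /=; rewrite (eqv_deriv j IH)// !eval_lap.
rewrite -[deriv j (lap _)]/(derivs [:: j] _) derivs_addl eval_addl big_map.
rewrite big_map big_enum/=; apply: eq_bigr => i _; rewrite deriv_comm; apply: eqv_deriv => // y _.
exact: deriv_comm.
Qed.

Lemma lap_Mul t u e x : eval (lap (Mul t u)) e x =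
  eval t e x * eval (lap u) e x + eval u e x * eval (lap t) e x +
  2 * \sum_i eval (deriv i t) e x * eval (deriv i u) e x.
Proof.
rewrite !eval_lap !mulr_sumr -!big_split/=; apply: eq_bigr => i _ /=; ring.
Qed.

Lemma lap_scale c t e x : eval (lap (Mul (Cst N c) t)) e x = c * eval (lap t) e x.
Proof.
rewrite !eval_lap mulr_sumr; apply: eq_bigr => i _ /=; ring.
Qed.

(* The Laplacian of [|x|^(2a)] is [lapc a * |x|^(2a-2)]. *)
Definition lapc (a : R) : R := 2 * a * (2 * a + N%:R - 2).

Lemma lap_Pow a : eqv (lap (Pow N a)) (Mul (Cst N (lapc a)) (Pow N (a - 1))).
Proof.
move=> x x0; have r0 : rho 0 x != 0 by rewrite gt_eqF// rho0_gt0.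
rewrite eval_lap /=.
(* Absorbing [|x|^2] brings all terms to the same power, so that only a polynomial identity
   remains. *)
have pE : rho 0 x * rho 0 x `^ (a - 1 - 1) = rho 0 x `^ (a - 1).
  rewrite -[X in X * _]powRr1 ?rho_ge0// -powRD ?r0 ?implybT//.
  by congr (_ `^ _); ring.
transitivity (\sum_(i < N) (2 * a * rho 0 x `^ (a - 1) +
    4 * a * (a - 1) * rho 0 x `^ (a - 1 - 1) * x 0 i ^+ 2)).
  by apply: eq_bigr => i _; rewrite eqxx mulr1n; ring.
rewrite big_split/= sumr_const card_ord -mulr_sumr.
have -> : \sum_(i < N) x 0 i ^+ 2 = rho 0 x by rewrite /rho addr0.
rewrite -[in RHS]pE -[in LHS]pE -mulr_natr /lapc; ring.
Qed.

(** Lists in place of tuples let inductions on [k] peel off the first letter, which is the outermost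
    derivative; [sum_words] returns to tuples. *)
Fixpoint words k : seq (seq 'I_N) :=
  if k is k'.+1 then [seq i :: s | s <- words k', i <- enum 'I_N] else [:: [::]].

Lemma big_words k (F : seq 'I_N -> R) :
  \sum_(s <- words k.+1) F s = \sum_(s <- words k) \sum_i F (i :: s).
Proof.
rewrite /= big_allpairs_dep; apply: eq_bigr => s _; by rewrite big_enum.
Qed.

(** The pointwise inner product of the tensors nabla^k f and nabla^k g. *)
Definition Bsum k f g := addl [seq Mul (derivs s f) (derivs s g) | s <- words k].

(** The divergence div_k (w nabla^k f). *)
Definition Dsum k w f := addl [seq derivs s (Mul w (derivs s f)) | s <- words k].

Lemma eval_Bsum k f g e x : eval (Bsum k f g) e x =
  \sum_(s <- words k) eval (derivs s f) e x * eval (derivs s g) e x.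
Proof. by rewrite eval_addl big_map. Qed.

Lemma eval_Dsum k w f e x : eval (Dsum k w f) e x =
  \sum_(s <- words k) eval (derivs s (Mul w (derivs s f))) e x.
Proof. by rewrite eval_addl big_map. Qed.

(** Take [F = derivs s f] and [G = derivs s g] in the rule for [2 grad F . grad G], sum over [s],
    and commute [lap] with [derivs s]. *)
Lemma BsumS k f g x : x != 0 -> eval (Bsum k.+1 f g) 0 x =
  2^-1 * (eval (lap (Bsum k f g)) 0 x - eval (Bsum k f (lap g)) 0 x
          - eval (Bsum k (lap f) g) 0 x).
Proof.
move=> x0; rewrite eval_Bsum big_words lap_addl big_map !eval_Bsum -!sumrB mulr_sumr.
apply: eq_bigr => s _; rewrite lap_Mul !(derivs_lap s)//=; by field.
Qed.

(** Moving the outer derivative along the first letter inside [derivs s] leaves [derivs s] of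
    [U = div (w grad G)], where [G = derivs s f]. The rule for this divergence is then applied under
    [derivs s]. *)
Lemma DsumS k w f x : x != 0 -> eval (Dsum k.+1 w f) 0 x =
  2^-1 * (eval (lap (Dsum k w f)) 0 x + eval (Dsum k w (lap f)) 0 x
          - eval (Dsum k (lap w) f) 0 x).
Proof.
move=> x0; rewrite eval_Dsum big_words lap_addl big_map !eval_Dsum.
rewrite -big_split/= -sumrB mulr_sumr; apply: eq_bigr => s _ /=.
set G := derivs s f.
pose U := addl [seq deriv i (Mul w (deriv i G)) | i <- enum 'I_N].
transitivity (eval (derivs s U) 0 x).
  rewrite /U derivs_addl eval_addl big_map big_map big_enum/=.
  by apply: eq_bigr => i _; have := derivs_deriv s i (Mul w (deriv i G)) x0.
have UE : eqv U (Mul (Cst N 2^-1)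
    (Add (Add (lap (Mul w G)) (Mul w (derivs s (lap f))))
         (Mul (Cst N (-1)) (Mul (lap w) G)))).
  move=> y y0; rewrite /= lap_Mul derivs_lap// -/G /U eval_addl big_map big_enum/=.
  rewrite !eval_lap big_split/= -mulr_sumr; by field.
rewrite (eqv_derivs s UE)// derivs_scale//= 2!derivs_Add/= derivs_scale//=.
by rewrite derivs_lap//; ring.
Qed.

Lemma eqv_BsumMr k f g g' c : eqv g (Mul (Cst N c) g') ->
  forall x, x != 0 -> eval (Bsum k f g) 0 x = c * eval (Bsum k f g') 0 x.
Proof.
move=> gg x x0; rewrite !eval_Bsum mulr_sumr; apply: eq_bigr => s _.
by rewrite (eqv_derivs s gg)// derivs_scale//= mulrCA.
Qed.

Lemma eqv_BsumMl k f f' g c : eqv f (Mul (Cst N c) f') ->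
  forall x, x != 0 -> eval (Bsum k f g) 0 x = c * eval (Bsum k f' g) 0 x.
Proof.
move=> gg x x0; rewrite !eval_Bsum mulr_sumr; apply: eq_bigr => s _.
by rewrite (eqv_derivs s gg)// derivs_scale//= mulrA.
Qed.

Lemma eqv_DsumMr k w f f' c : eqv f (Mul (Cst N c) f') ->
  forall x, x != 0 -> eval (Dsum k w f) 0 x = c * eval (Dsum k w f') 0 x.
Proof.
move=> ff x x0; rewrite !eval_Dsum mulr_sumr; apply: eq_bigr => s _.
rewrite -[RHS]/(eval (Mul (Cst N c) (derivs s (Mul w (derivs s f')))) 0 x).
rewrite -derivs_scale//; apply: (eqv_derivs s) => // y y0 /=.
by rewrite (eqv_derivs s ff)// derivs_scale//= mulrCA.
Qed.

Lemma eqv_DsumMl k w w' f c : eqv w (Mul (Cst N c) w') ->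
  forall x, x != 0 -> eval (Dsum k w f) 0 x = c * eval (Dsum k w' f) 0 x.
Proof.
move=> ff x x0; rewrite !eval_Dsum mulr_sumr; apply: eq_bigr => s _.
rewrite -[RHS]/(eval (Mul (Cst N c) (derivs s (Mul w' (derivs s f)))) 0 x).
rewrite -derivs_scale//; apply: (eqv_derivs s) => // y y0 /=.
by rewrite ff// mulrA.
Qed.

(** The three terms are those of [BsumS], evaluated by [lap_Pow]; the first is the Laplacian of the
    power [a + b - k']. *)
Fixpoint bc k (a b : R) : R :=
  if k is k'.+1 then
    2^-1 * (lapc (a + b - k'%:R) * bc k' a b - lapc b * bc k' a (b - 1)
            - lapc a * bc k' (a - 1) b)
  else 1.

(** Obtained in the same way from [DsumS]. *)
Fixpoint dc k (m a : R) : R :=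
  if k is k'.+1 then
    2^-1 * (lapc (m + a - k'%:R) * dc k' m a + lapc a * dc k' m (a - 1)
            - lapc m * dc k' (m - 1) a)
  else 1.

Lemma Bsum_Pow k a b :
  eqv (Bsum k (Pow N a) (Pow N b)) (Mul (Cst N (bc k a b)) (Pow N (a + b - k%:R))).
Proof.
elim: k a b => [|k IH] a b x x0.
  have r0 : rho 0 x != 0 by rewrite gt_eqF// rho0_gt0.
  by rewrite eval_Bsum /= big_seq1 /= mul1r subr0 powRD// r0 implybT.
rewrite BsumS// (eqv_lap (IH a b))// lap_scale lap_Pow//=.
rewrite (eqv_BsumMr _ _ (@lap_Pow b))// (eqv_BsumMl _ _ (@lap_Pow a))// !IH//=.
have -> : a + b - k%:R - 1 = a + b - k.+1%:R by rewrite -natr1; ring.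
have -> : a + (b - 1) - k%:R = a + b - k.+1%:R by rewrite -natr1; ring.
have -> : a - 1 + b - k%:R = a + b - k.+1%:R by rewrite -natr1; ring.
ring.
Qed.

Lemma Dsum_Pow k m a :
  eqv (Dsum k (Pow N m) (Pow N a)) (Mul (Cst N (dc k m a)) (Pow N (m + a - k%:R))).
Proof.
elim: k m a => [|k IH] m a x x0.
  have r0 : rho 0 x != 0 by rewrite gt_eqF// rho0_gt0.
  by rewrite eval_Dsum /= big_seq1 /= mul1r subr0 powRD// r0 implybT.
rewrite DsumS// (eqv_lap (IH m a))// lap_scale lap_Pow//=.
rewrite (eqv_DsumMr _ _ (@lap_Pow a))// (eqv_DsumMl _ _ (@lap_Pow m))// !IH//=.
have -> : m + a - k%:R - 1 = m + a - k.+1%:R by rewrite -natr1; ring.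
have -> : m + (a - 1) - k%:R = m + a - k.+1%:R by rewrite -natr1; ring.
have -> : m - 1 + a - k%:R = m + a - k.+1%:R by rewrite -natr1; ring.
ring.
Qed.

(* Up to sign, [dc] and [bc] obey the same recurrence, because
   [lapc (1 - N/2 - a) = lapc a]. *)
Lemma dc_bc k m a b : m + a + b = k%:R - N%:R / 2 ->
  (-1) ^+ k * dc k m a = bc k a b.
Proof.
elim: k m a b => [|k IH] m a b mab /=; first by rewrite expr0 mul1r.
rewrite -natr1 in mab.
(* Lowering [k] and any one of the three exponents by 1 preserves the relation, so the induction
   hypothesis reaches all three terms. *)
rewrite -(IH m a (b - 1)); last by move: mab; lra.
rewrite -(IH m (a - 1) b); last by move: mab; lra.
rewrite -(IH (m - 1) a b); last by move: mab; lra.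
(* The outer Laplacian of each recurrence pairs with a factor of the other: [lapc (m + a - k)] with
   [lapc b], and [lapc (a + b - k)] with [lapc m]. *)
have -> : lapc (m + a - k%:R) = lapc b.
  have -> : m + a - k%:R = 1 - N%:R / 2 - b by move: mab; lra.
  rewrite /lapc; by field.
have -> : lapc (a + b - k%:R) = lapc m.
  have -> : a + b - k%:R = 1 - N%:R / 2 - m by move: mab; lra.
  rewrite /lapc; by field.
rewrite exprS; ring.
Qed.

End identities.

(** * Measure and integration on R^n *)

Section integration_rV.
Variable R : realType.
Local Open Scope ereal_scope.

(** The measure in dimension [n.+1] is by definition a pushforward along [rV_cons]; on the product,
    integrals can be iterated. *)
Lemma ge0_integral_rV_cons n (f : 'rV[R]_n.+1 -> \bar R) :
  measurable_fun setT f -> (forall x, 0 <= f x) ->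
  \int[lebesgue_rV R n.+1]_x f x =
  \int[lebesgue_measure \x lebesgue_rV R n]_p f (rV_cons p).
Proof.
move=> mf f0.
rewrite -[LHS]/(\int[pushforward (lebesgue_measure \x lebesgue_rV R n)
   (@rV_cons R n)]_x f x).
rewrite ge0_integral_pushforward//; exact: measurable_rV_cons.
Qed.

Lemma integrable_rV_cons n (f : 'rV[R]_n.+1 -> \bar R) :
  (lebesgue_rV R n.+1).-integrable setT f ->
  (lebesgue_measure \x lebesgue_rV R n).-integrable setT (f \o @rV_cons R n).
Proof.
move=> /integrableP[mf foo]; apply/integrableP; split.
  by apply: measurableT_comp => //; exact: measurable_rV_cons.
rewrite ge0_integral_rV_cons// in foo.
exact: measurableT_comp.
Qed.

Lemma integral_rV_cons n (f : 'rV[R]_n.+1 -> \bar R) :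
  (lebesgue_rV R n.+1).-integrable setT f ->
  \int[lebesgue_rV R n.+1]_x f x =
  \int[lebesgue_measure \x lebesgue_rV R n]_p f (rV_cons p).
Proof.
move=> fi.
rewrite -[LHS]/(\int[pushforward (lebesgue_measure \x lebesgue_rV R n)
   (@rV_cons R n)]_x f x).
have /integrableP[mf _] := fi.
rewrite integral_pushforward//; first exact: measurable_rV_cons.
exact: integrable_rV_cons.
Qed.

Lemma measurable_coord n (i : 'I_n) :
  measurable_fun setT (fun x : 'rV[R]_n => x ord0 i).
Proof. exact: measurable_rV_coord. Qed.

(** Tonelli splits off the first coordinate: the integral is that of [f] times the one in dimension
    [n], both finite. *)
Lemma integral_prod_coord_lty (f : R -> R) n :
  measurable_fun setT f -> (forall t, (0 <= f t)%R) ->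
  \int[lebesgue_measure]_t (f t)%:E < +oo ->
  \int[lebesgue_rV R n]_x (\prod_(i < n) f (x ord0 i))%:E < +oo.
Proof.
move=> mf f0 foo; elim: n => [|n IH].
  rewrite integral_dirac//=; last first.
    by rewrite (_ : (fun _ => _) = cst 1%:E)//; apply/funext => x; rewrite big_ord0.
  by rewrite diracT mul1e big_ord0 ltry.
have mP m : measurable_fun setT (fun x : 'rV[R]_m => (\prod_(i < m) f (x ord0 i))%:E).
  apply/measurable_EFinP/measurable_prod => i _.
  by apply: measurableT_comp => //; exact: measurable_coord.
have P0 m (x : 'rV[R]_m) : 0 <= (\prod_(i < m) f (x ord0 i))%:E.
  by rewrite lee_fin prodr_ge0.
rewrite ge0_integral_rV_cons// fubini_tonelli1//; last first.
  exact: (measurableT_comp (mP n.+1) (@measurable_rV_cons R n)).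
rewrite (eq_integral (fun t : measurableTypeR R => (f t)%:E *
    \int[lebesgue_rV R n]_x (\prod_(i < n) f (x ord0 i))%:E)); last first.
  move=> t _; rewrite -ge0_integralZl//; last 2 first.
  - exact: mP.
  - by rewrite lee_fin.
  apply: eq_integral => y _; rewrite big_ord_recl -EFinM mxE unlift_none/=.
  by congr (_ * _)%:E; apply: eq_bigr => i _; rewrite mxE liftK.
rewrite ge0_integralZr//; last 3 first.
- exact/measurable_EFinP.
- by move=> t _; rewrite lee_fin.
- by apply: integral_ge0 => x _; exact: P0.
rewrite lte_mul_pinfty//.
- by apply: integral_ge0 => x _; rewrite lee_fin.
- by rewrite ge0_fin_numE//; apply: integral_ge0 => x _; rewrite lee_fin.
Qed.

(** The hyperplane is a box with one side of length 0, and [0 * +oo = 0] takes care of the infinite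
    sides. *)
Lemma lebesgue_rV_coord0 n (i : 'I_n) :
  lebesgue_rV R n [set x : 'rV[R]_n | x ord0 i = 0%R] = 0.
Proof.
pose A j : set (measurableTypeR R) := if j == i then [set 0%R] else setT.
rewrite (_ : mkset _ = [set x : 'rV[R]_n | forall j, A j (x ord0 j)]).
  rewrite lebesgue_rV_box => [|j]; last by rewrite /A; case: ifP.
  rewrite (bigD1 i)//= {1}/A eqxx.
  by rewrite (_ : lebesgue_measure _ = 0) ?mul0e//; exact: lebesgue_measure_set1.
apply/seteqP; split => x /=.
  by move=> x0 j; rewrite /A; case: eqP => [->|].
by move=> /(_ i); rewrite /A eqxx.
Qed.

Lemma measurable_coord0 n (i : 'I_n) :
  measurable [set x : 'rV[R]_n | x ord0 i = 0%R].
Proof.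
rewrite (_ : [set x : 'rV[R]_n | x ord0 i = 0%R] =
  (fun x : 'rV[R]_n => x ord0 i) @^-1` [set 0%R])//.
by rewrite -[X in measurable X]setTI; exact: measurable_coord.
Qed.

Lemma ae_coord_neq0 n :
  {ae lebesgue_rV R n, forall x : 'rV[R]_n, forall i, x ord0 i != 0%R}.
Proof.
apply: filter_forall => i; exists [set x : 'rV[R]_n | x ord0 i = 0%R]; split.
- exact: measurable_coord0.
- exact: lebesgue_rV_coord0.
- by move=> x /= /negP; rewrite negbK => /eqP.
Qed.

End integration_rV.

(** * Cubes, compact sets and Borel measurability in R^n *)

Section topology_rV.
Variables (R : realType) (n : nat).
Local Notation E := 'rV[R]_n.

Lemma normr_coord (x : E) i : `|x 0 i| <= `|x|.
Proof.
rewrite [leRHS]/Num.norm/= mx_normrE.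
exact: (le_bigmax _ (fun ij : 'I_1 * 'I_n => `|x ij.1 ij.2|) (0, i)).
Qed.

(** Compact sets and supports are enlarged to cubes, whose measure is a product of lengths. *)
Definition cube (M : R) : set E := [set x : E | forall i, `|x 0 i| <= M].

Lemma cube_compact M : compact (cube M).
Proof.
rewrite (_ : cube M = [set v : E | forall i, `[-M, M]%classic (v ord0 i)]).
  by apply: (@rV_compact _ _ (fun=> `[-M, M]%classic)) => _; exact: segment_compact.
by apply/seteqP; split => x /= h i; have := h i; rewrite in_itv/= ler_norml.
Qed.

Lemma compact_sub_cube (K : set E) : compact K -> exists2 M, 0 < M & K `<=` cube M.
Proof.
move=> /compact_bounded[M [Mreal KM]]; exists (`|M| + 1).
  by rewrite ltr_wpDl.
move=> x Kx i; apply: (le_trans (normr_coord x i)); apply: KM => //.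
by rewrite (le_lt_trans (ler_norm _))// ltrDl.
Qed.

(** The sigma-algebra is generated by the coordinates, so an open set is written as a countable
    union of boxes with rational centres and radii [1 / (k + 1)]. *)
Lemma open_measurable_rV (U : set E) : open U -> measurable U.
Proof.
move=> oU.
pose box (p : 'rV[rat]_n * nat) : set E :=
  [set x : E | forall i, `|x 0 i - ratr (p.1 0 i)| < p.2.+1%:R^-1].
have mbox p : measurable (box p).
  rewrite (_ : box p = \bigcap_(i in [set: 'I_n])
      ((fun x : E => x 0 i) @^-1` ball (ratr (p.1 0 i) : R) (p.2.+1%:R^-1))).
    apply: fin_bigcap_measurable => // i _.
    rewrite -[X in measurable X]setTI; apply: measurable_rV_coord => //.
    exact: measurable_ball.
  apply/seteqP; split => x /= h i; first by move=> _; rewrite /ball/= distrC; exact: h.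
  by have := h i I; rewrite /ball/= distrC.
rewrite (_ : U = \bigcup_p (if `[< box p `<=` U >] then box p else set0)).
  apply: countable_bigcupT_measurable => [|p]; first exact: countableP.
  by case: ifP.
apply/seteqP; split => x; last first.
  by move=> [p _]; case: ifPn => // /asboolP; apply.
move=> Ux; have /nbhs_ballP[e /= e0 eU] : nbhs x U by exact: open_nbhs_nbhs.
(* A box of radius below [e / 2] that contains [x] stays within [e] of [x]. *)
have [k ke] : exists k : nat, k.+1%:R^-1 < e / 2 :> R.
  have e2 : 0 < e / 2 by rewrite divr_gt0.
  have := @cvg_harmonic R => /cvgrPdist_lt/(_ _ e2)[k _ /(_ k (leqnn k))].
  by rewrite sub0r normrN ger0_norm ?harmonic_ge0//; exists k.
have qx i : exists q : rat, `|x 0 i - ratr q| < k.+1%:R^-1.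
  have [|q] := @rat_in_itvoo R (x 0 i - k.+1%:R^-1) (x 0 i + k.+1%:R^-1).
    by rewrite ltrBlDr -addrA ltrDl addr_gt0// invr_gt0.
  rewrite in_itv/= => /andP[q1 q2]; exists q.
  rewrite ltr_norml ltrBrDl ltrBlDr q2/= ltrBlDl -ltrBlDr; exact: q1.
pose q : 'rV[rat]_n := \row_i sval (cid (qx i)).
exists (q, k) => //=; case: ifPn => [_ i /=|/asboolP[]].
  by rewrite mxE; case: cid.
move=> y /= yq; apply: eU; split => // i j; rewrite (ord1 i) /ball/=.
have := yq j; rewrite mxE; case: cid => /= r xr yr.
have -> : x 0 j - y 0 j = (x 0 j - ratr r) - (y 0 j - ratr r) by ring.
by rewrite (le_lt_trans (ler_normB _ _))// [ltRHS]splitr ltrD// (lt_trans _ ke).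
Qed.

Lemma closed_measurable_rV (A : set E) : closed A -> measurable A.
Proof. by move/closed_openC/open_measurable_rV/measurableC; rewrite setCK. Qed.

Lemma cube_closed M : closed (cube M).
Proof. by apply: compact_closed; [exact: norm_hausdorff|exact: cube_compact]. Qed.

Lemma compact_measurable_rV (K : set E) : compact K -> measurable K.
Proof.
move=> /compact_closed cK; apply: closed_measurable_rV; apply: cK.
exact: norm_hausdorff.
Qed.

Lemma continuous_measurable_rV (f : E -> R) : continuous f -> measurable_fun setT f.
Proof.
move=> /continuousP cf; apply: (measurability _ (RGenOpens.measurableE R)).
move=> _ [_ [a [b ->] <-]]; rewrite setTI; apply: open_measurable_rV.
exact/cf/interval_open.
Qed.

Lemma continuous_bounded_cube (f : E -> R) M : continuous f ->
  exists2 C, 0 <= C & forall x, cube M x -> `|f x| <= C.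
Proof.
move=> cf.
have : bounded_set (f @` cube M).
  apply/compact_bounded/continuous_compact; last exact: cube_compact.
  exact: continuous_subspaceT.
move=> [C [_ hC]]; exists (`|C| + 1); first by rewrite addr_ge0.
move=> x Mx; apply: (hC (`|C| + 1)); last by exists x.
by rewrite (le_lt_trans (ler_norm _))// ltrDl.
Qed.

End topology_rV.

(** * Integrability of bounded functions supported in a cube *)

Section integrable_cube.
Variables (R : realType) (n : nat).
Local Notation E := 'rV[R]_n.

Lemma lebesgue_rV_cube_lty M : (lebesgue_rV R n (@cube R n M) < +oo)%E.
Proof.
pose A : set (measurableTypeR R) := `[-M, M]%classic.
rewrite (_ : cube M = [set x : E | forall i : 'I_n, A (x 0 i)]); last first.
  by apply/seteqP; split => x /= h i; have := h i; rewrite /A/= in_itv/= ler_norml.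
rewrite (@lebesgue_rV_box R n (fun=> A)) => [|i]; last exact: measurable_itv.
(* Nonnegativity is carried along because finiteness of a product relies on it. *)
suff : (0 <= \prod_(i < n) lebesgue_measure A < +oo)%E by case/andP.
elim/big_ind : _ => [|x y /andP[x0 xoo] /andP[y0 yoo]|i _].
- by rewrite lee01 ltry.
- by rewrite mule_ge0//= lte_mul_pinfty// ge0_fin_numE.
- rewrite measure_ge0/= (_ : lebesgue_measure A = lebesgue_measure `[-M, M]%classic)//.
  by rewrite lebesgue_measure_itv/=; case: ifP => _; rewrite ?ltry.
Qed.

Lemma cube_measurable M : measurable (@cube R n M).
Proof. by apply: closed_measurable_rV; exact: cube_closed. Qed.

Lemma integrable_bounded_cube (f : E -> R) M C : measurable_fun setT f ->
  (forall x, cube M x -> `|f x| <= C) -> (forall x, ~ cube M x -> f x = 0) ->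
  (lebesgue_rV R n).-integrable setT (EFin \o f).
Proof.
move=> mf fC f0; apply/integrableP; split; first exact/measurable_EFinP.
(* The absolute value keeps the constant nonnegative even if the cube is empty and [C] is
   negative. *)
apply: (@le_lt_trans _ _ (\int[lebesgue_rV R n]_(x in cube M) (cst `|C|%:E x))%E).
  rewrite [leRHS]integral_mkcond; apply: ge0_le_integral => //.
  - by apply: measurableT_comp => //; exact/measurable_EFinP.
  - by apply/(measurable_restrictT _ (cube_measurable M)); exact: measurable_cst.
  - move=> x _; rewrite patchE; case: ifPn => [|/negP]; rewrite inE => xM.
      by rewrite /= lee_fin (le_trans (fC _ xM))// ler_norm.
    by rewrite /= f0// normr0.
rewrite integral_cst//; last exact: cube_measurable.
by rewrite lte_mul_pinfty// ?lee_fin// lebesgue_rV_cube_lty.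
Qed.

End integrable_cube.

(** * The integral of a partial derivative *)

Section divergence.
Variable R : realType.

(** Since [phi] sends the line along [v] to the line along [w], the two difference quotients are the
    same function of [t]. This serves to restrict [h] to slices through [rV_cons]. *)
Lemma derive_comp_affine (V W : normedModType R) (phi : V -> W) (h : W -> R) x v w :
  (forall t : R, phi (t *: v + x) = t *: w + phi x) ->
  (derivable (h \o phi) x v <-> derivable h (phi x) w) /\
  'D_v (h \o phi) x = 'D_w h (phi x).
Proof.
move=> phiE.
have E : (fun t : R => t^-1 *: (((h \o phi) \o shift x) (t *: v) - (h \o phi) x)) =
         (fun t : R => t^-1 *: ((h \o shift (phi x)) (t *: w) - h (phi x))).
  by apply/funext => t /=; rewrite phiE.
by split; [rewrite /derivable E|rewrite /derive E].
Qed.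

Lemma derive_outside_closed (V : normedModType R) (K : set V) (h : V -> R) v :
  closed K -> (forall x, ~ K x -> h x = 0) -> forall x, ~ K x -> 'D_v h x = 0.
Proof.
move=> cK h0 x Kx; rewrite (@near_eq_derive _ _ _ _ (cst 0)) ?derive_cst//.
have : nbhs x (~` K) by apply: open_nbhs_nbhs; split => //; exact: closed_openC.
by apply: filterS => y /h0.
Qed.

Lemma integral_derive1_eq0 (g : R -> R) M : (forall t, derivable g t 1) ->
  continuous (g^`())%classic -> (forall t, M < `|t| -> g t = 0) ->
  (\int[lebesgue_measure]_t (g^`()%classic t)%:E = 0)%E.
Proof.
(* This [b] is positive and exceeds [M], so [g] vanishes at both endpoints and the fundamental
   theorem of calculus gives 0. *)
move=> dg cg g0; set b := `|M| + 1.
have b0 : 0 < b by rewrite ltr_wpDl.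
have Mb t : b <= `|t| -> M < `|t|.
  by apply: lt_le_trans; rewrite (le_lt_trans (ler_norm _))// ltrDl.
have gc : continuous g.
  by move=> t; apply: differentiable_continuous; exact/derivable1_diffP.
transitivity (\int[lebesgue_measure]_(t in `[(- b)%R, b]) (g^`()%classic t)%:E)%E.
  rewrite [RHS]integral_mkcond; apply: eq_integral => t _; rewrite patchE.
  case: ifPn => // tb; rewrite derive1E (@derive_outside_closed _ `[-b, b]%classic)//.
  - exact: interval_closed.
  - move=> x /= xb; apply/g0/Mb; rewrite leNgt; apply/negP => xb'; apply: xb.
    by rewrite in_itv/= -ler_norml ltW.
  - by move=> tb'; move: tb; rewrite notin_setE; exact.
have bb : - b < b by rewrite -subr_gt0 opprK addr_gt0.
have dLR : derivable_oo_LRcontinuous g (- b) b.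
  by split; [move=> x _; exact: dg|apply: cvg_at_right_filter; exact: gc|
    apply: cvg_at_left_filter; exact: gc].
have cgb : {within `[- b, b], continuous (g^`())%classic}.
  exact: continuous_subspaceT.
have -> := continuous_FTC2 bb cgb dLR (fun=> fun=> erefl).
by rewrite !g0 ?subee//; apply: Mb; rewrite ?normrN ger0_norm// ltW.
Qed.

Lemma rV_cons_continuous_r n (a : R) : continuous (fun y => @rV_cons R n (a, y)).
Proof.
move=> y A /nbhs_ballP[e /= e0 eA]; apply/nbhs_ballP; exists e => // z [_ yz].
apply: eA; split => // i j; rewrite !mxE/=.
by case: unliftP => [k _|_] /=; [exact: yz|exact: ballxx].
Qed.

Lemma rV_cons_continuous_l n (y : 'rV[R]_n) :
  continuous (fun a : R => rV_cons (a, y) : 'rV[R]_n.+1).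
Proof.
move=> a A /nbhs_ballP[e /= e0 eA]; apply/nbhs_ballP; exists e => // z az.
apply: eA; split => // i j; rewrite !mxE/=.
by case: unliftP => [k _|_] /=; [exact: ballxx|exact: az].
Qed.

Lemma rV_cons_shift_l n (y : 'rV[R]_n) (a t : R) :
  rV_cons (t *: (1 : R) + a, y) = t *: delta_mx 0 0 + rV_cons (a, y) :> 'rV[R]_n.+1.
Proof.
apply/rowP => i; rewrite !mxE /=; case: (unliftP 0 i) => [k ->|->] /=.
  by rewrite mulr0 add0r.
by congr (_ + _).
Qed.

Lemma rV_cons_shift_r n (y : 'rV[R]_n) (a t : R) j :
  rV_cons (a, t *: delta_mx 0 j + y) =
  t *: delta_mx 0 (lift 0 j) + rV_cons (a, y) :> 'rV[R]_n.+1.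
Proof.
apply/rowP => i; rewrite !mxE /=; case: (unliftP 0 i) => [k ->|->] /=.
  by rewrite !mxE eqxx /= (inj_eq lift_inj).
by rewrite mulr0 add0r.
Qed.

(** Fubini and induction on the dimension. If [i] is not the first coordinate, freeze the first and
    use the induction hypothesis on the slice; otherwise freeze the others and use
    [integral_derive1_eq0]. *)
Lemma integral_partial_eq0 n (i : 'I_n) (h : 'rV[R]_n -> R) M :
  (forall x, derivable h x (delta_mx 0 i)) -> continuous (partial i h) ->
  (forall x, ~ cube M x -> h x = 0) ->
  (\int[lebesgue_rV R n]_x (partial i h x)%:E = 0)%E.
Proof.
elim: n i h => [[]//|n IH] i h dh cdh h0.
have dh0 x : ~ cube M x -> partial i h x = 0.
  by apply: derive_outside_closed => //; exact: cube_closed.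
have [C _ hC] := continuous_bounded_cube M cdh.
have hi := integrable_bounded_cube (continuous_measurable_rV cdh) hC dh0.
rewrite integral_rV_cons//; have ci := integrable_rV_cons hi.
have [j ij|i0] := unliftP 0 i.
  rewrite -(integral12_prod_meas1 ci)//; apply: integral0_eq => a _.
  have E y := @derive_comp_affine 'rV[R]_n 'rV[R]_n.+1
    (fun y => rV_cons (a, y)) h _ _ _ (fun t => rV_cons_shift_r y a t j).
  rewrite -ij in E.
  have <- := IH j (h \o (fun y => rV_cons (a, y))).
  - by apply: eq_integral => y _; congr EFin; rewrite /partial -(E y).2.
  - by move=> y; apply/(E y).1; exact: dh.
  - have -> : partial j (h \o (fun y => rV_cons (a, y))) =
              partial i h \o (fun y => rV_cons (a, y)).
      by apply/funext => y; exact: (E y).2.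
    by move=> y; apply: continuous_comp; [exact: rV_cons_continuous_r|exact: cdh].
  - move=> y My; apply: h0 => hM; apply: My => k.
    by have := hM (lift 0 k); rewrite mxE liftK.
rewrite -(integral21_prod_meas1 ci)//; apply: integral0_eq => y _.
have E a := @derive_comp_affine R 'rV[R]_n.+1
  (fun a => rV_cons (a, y)) h _ _ _ (fun t => rV_cons_shift_l y a t).
rewrite -i0 in E.
have gE : ((h \o (fun a => rV_cons (a, y))) ^`())%classic =
    partial i h \o (fun a : R => rV_cons (a, y)).
  by apply/funext => a; rewrite derive1E; exact: (E a).2.
have := @integral_derive1_eq0 (h \o (fun a => rV_cons (a, y))) M.
rewrite gE; apply.
- by move=> a; apply/(E a).1; exact: dh.
- by move=> a; apply: continuous_comp; [exact: rV_cons_continuous_l|exact: cdh].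
- move=> a Ma; apply: h0 => hM; have := hM 0; rewrite mxE unlift_none/=.
  by rewrite leNgt Ma.
Qed.

End divergence.

(** * Local integrability of powers *)

Section power_integral.
Variable R : realType.

Lemma le0_ger_powR (r x y : R) : r <= 0 -> 0 < x -> x <= y -> y `^ r <= x `^ r.
Proof.
move=> r0 x0 xy; rewrite -(opprK r) !(powRN _ (- r)).
have y0 : 0 < y by exact: lt_le_trans xy.
rewrite lef_pV2 ?posrE ?powR_gt0//.
by rewrite ge0_ler_powR// ?nnegrE ?oppr_ge0// ltW.
Qed.

(** The limit [e -> 0] is taken along [harmonic n = 1 / (n + 1)], as the convergence theorems for
    integrals concern sequences. *)
Lemma cvg_powR_harmonic (x b : R) : 0 < x ->
  (x + harmonic n) `^ b @[n --> \oo] --> x `^ b.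
Proof.
move=> x0; have xh : x + harmonic n @[n --> \oo] --> x.
  by rewrite -[X in _ --> X]addr0; apply: cvgD; [exact: cvg_cst|exact: cvg_harmonic].
apply: (cvg_comp (fun n => x + harmonic n) (@powR R ^~ b) xh).
apply: (@differentiable_continuous _ _ _ x (@powR R ^~ b)).
by apply/derivable1_diffP; apply: ex_derive; exact: is_derive1_powR.
Qed.

Let F (e b : R) : R -> R := id * ((@powR R ^~ b) \o (fun t => t * t + e)).

Let G (e b t : R) : R :=
  (t * t + e) `^ b + t * (b * (t * t + e) `^ (b - 1) * (t + t)).

Let u0 (e t : R) : 0 < e -> 0 < t * t + e.
Proof. by move=> e0; rewrite ltr_wpDl// -expr2 sqr_ge0. Qed.

Let u_der (e t : R) : is_derive t 1 (fun t => t * t + e) (t + t).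
Proof.
rewrite (_ : (fun t => t * t + e) = (id * id) + cst e)//.
by apply: is_derive_eq; rewrite addr0 /GRing.scale/= mulr1.
Qed.

Let pow_der (e b t : R) : 0 < e ->
  is_derive t 1 ((@powR R ^~ b) \o (fun t => t * t + e))
    (b * (t * t + e) `^ (b - 1) * (t + t)).
Proof.
move=> e0; have ? := u_der e t; have ? := is_derive1_powR b (u0 t e0).
exact: is_derive1_comp.
Qed.

Let F_der (e b t : R) : 0 < e -> is_derive t 1 (F e b) (G e b t).
Proof.
move=> e0; have ? := pow_der b t e0.
by apply: is_derive_eq; rewrite /G /GRing.scale/= mulr1 addrC.
Qed.

Let pow_cont (e b : R) : 0 < e -> continuous (fun t : R => (t * t + e) `^ b).
Proof.
move=> e0 t; apply: differentiable_continuous; apply/derivable1_diffP.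
by have [+ _] := pow_der b t e0.
Qed.

Let G_cont (e b : R) : 0 < e -> continuous (G e b).
Proof.
move=> e0 t; apply: cvgD; first exact: pow_cont.
apply: cvgM => //; apply: cvgM; last exact: cvgD.
by apply: cvgM; [exact: cvg_cst|exact: pow_cont].
Qed.

(** Writing [t^2 = (t^2 + e) - e], the difference of the two sides is [- 2 b e (t^2 + e)^(b - 1)],
    nonnegative because [b <= 0]. *)
Let G_ge (e b t : R) : 0 < e -> b <= 0 -> (1 + 2 * b) * (t * t + e) `^ b <= G e b t.
Proof.
move=> e0 b0; rewrite /G -subr_ge0.
have ue : t * t + e != 0 by rewrite gt_eqF// u0.
have -> : (t * t + e) `^ b = (t * t + e) * (t * t + e) `^ (b - 1).
  rewrite powRD; last by rewrite ue implybT.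
  by rewrite powR_inv1 ?ltW ?u0// mulrCA mulfV// mulr1.
set p := (t * t + e) `^ (b - 1).
rewrite (_ : _ - _ = - b * (2 * e * p)); last by ring.
by rewrite mulr_ge0 ?oppr_ge0// mulr_ge0 ?powR_ge0// mulr_ge0// ltW.
Qed.

(* [G e b] is the derivative of [t (t^2 + e)^b], so [G_ge] bounds the integral
   uniformly in [e] by boundary values. *)
Lemma integral_shifted_powR_le (e b M : R) : 0 < e -> 0 < M -> - 2^-1 < b -> b <= 0 ->
  (\int[lebesgue_measure]_(t in `[(- M)%R, M]) ((t * t + e) `^ b)%:E <=
   ((1 + 2 * b)^-1 * (2 * M * (M * M) `^ b))%:E)%E.
Proof.
move=> e0 M0 b2 b0; have b1 : 0 < 1 + 2 * b by move: b2; lra.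
have MM : - M < M by rewrite -subr_gt0 opprK addr_gt0.
have mp (f : R -> R) : continuous f ->
    measurable_fun (`[- M, M]%classic : set (measurableTypeR R)) (fun t => (f t)%:E).
  move=> cf; apply/measurable_EFinP; apply: measurable_funTS.
  exact: continuous_measurable_fun.
have dF t := F_der b t e0.
have FTC : (\int[lebesgue_measure]_(t in `[(- M)%R, M]) (G e b t)%:E =
    (F e b M)%:E - (F e b (- M))%:E)%E.
  apply: continuous_FTC2 => //.
  - by apply: continuous_subspaceT; exact: G_cont.
  - split=> [x _||].
    + by have [] := dF x.
    + apply: cvg_at_right_filter; apply: differentiable_continuous.
      by apply/derivable1_diffP; have [] := dF (- M).
    + apply: cvg_at_left_filter; apply: differentiable_continuous.
      by apply/derivable1_diffP; have [] := dF M.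
  - by move=> x _; rewrite derive1E; have [_ ->] := dF x.
apply: (@le_trans _ _ (\int[lebesgue_measure]_(t in `[(- M)%R, M])
    ((1 + 2 * b)^-1 * G e b t)%:E)%E).
  apply: ge0_le_integral => //.
  - by move=> t _; rewrite lee_fin powR_ge0.
  - by apply: mp; exact: pow_cont.
  - apply: mp => t; apply: cvgM; [exact: cvg_cst|exact: G_cont].
  - by move=> t _; rewrite lee_fin ler_pdivlMl// G_ge.
under eq_integral do rewrite EFinM.
have G0 t : 0 <= G e b t.
  by apply: le_trans (G_ge t e0 b0); rewrite mulr_ge0 ?powR_ge0// ltW.
rewrite ge0_integralZl//; last 3 first.
- by apply: mp; exact: G_cont.
- by move=> t _; rewrite lee_fin.
- by rewrite lee_fin invr_ge0 ltW.
(* [F] is odd, so the boundary terms add up; dropping [e] from the power then only increases it,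
   because [b <= 0]. *)
have FE : F e b M - F e b (- M) = 2 * M * (M * M + e) `^ b.
  by rewrite /F !fctE/= mulrNN; ring.
rewrite FTC -EFinB FE -EFinM lee_fin ler_pM2l ?invr_gt0// ler_pM2l ?mulr_gt0//.
by apply: le0_ger_powR => //; [rewrite mulr_gt0|rewrite lerDl ltW].
Qed.

(** For [b < 0] the regularized powers tend to infinity at 0, whereas [powR 0 b] is 0; the origin is
    therefore removed. *)
Definition punctured (M : R) : set (measurableTypeR R) :=
  `[- M, M]%classic `&` ~` [set 0].

Lemma measurable_punctured M : measurable (punctured M).
Proof. by apply: measurableI => //; exact: measurableC. Qed.

(** As [e] decreases to 0 the regularized powers increase, and their integrals stay below [K]:
    monotone convergence. *)
Lemma integral_powR_lty (b M : R) : 0 < M -> - 2^-1 < b -> b <= 0 ->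
  (\int[lebesgue_measure]_(t in punctured M) ((t * t) `^ b)%:E < +oo)%E.
Proof.
move=> M0 b2 b0; set K : R := (1 + 2 * b)^-1 * (2 * M * (M * M) `^ b).
pose h n (t : measurableTypeR R) := ((t * t + harmonic n) `^ b)%:E.
have mh n : measurable_fun setT (h n).
  apply/measurable_EFinP; apply: (@continuous_measurable_fun R).
  by apply: pow_cont; exact: harmonic_gt0.
have h0 n t : (0 <= h n t)%E by rewrite lee_fin powR_ge0.
have nd t : {homo h ^~ t : n m / (n <= m)%N >-> (n <= m)%E}.
  move=> n m nm; rewrite lee_fin le0_ger_powR ?u0 ?harmonic_gt0//.
  by rewrite lerD2l /harmonic lef_pV2 ?posrE ?ltr0n// ler_nat.
have := @cvg_monotone_convergence _ _ _ lebesgue_measure _ (measurable_punctured M)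
  h (fun n => measurable_funTS (mh n)) (fun n t _ => h0 n t) (fun t _ => nd t).
rewrite (eq_integral (fun t : measurableTypeR R => ((t * t) `^ b)%:E)); last first.
  move=> t; rewrite inE => -[_ t0]; apply/cvg_lim => //; apply: cvg_EFin.
    by apply: nearW.
  apply: cvg_powR_harmonic; rewrite -expr2 exprn_even_gt0//=; exact/eqP.
move=> /cvge_to_le H; apply: (@le_lt_trans _ _ K%:E); last exact: ltry.
apply: H; apply: nearW => n.
apply: le_trans (integral_shifted_powR_le (harmonic_gt0 n) M0 b2 b0).
apply: ge0_subset_integral => //.
- exact: measurable_punctured.
- exact: measurable_funTS.
- by move=> t [].
Qed.

End power_integral.

(** * Homogeneous expressions: growth, integrability and domination *)

Section homogeneous.
Variables (R : realType) (N : nat).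
Local Notation E := 'rV[R]_N.
Local Notation expr := (expr R N).

(** The degree counts [x] and the square root of [rho e] as 1. Zero has every degree, since
    differentiating a constant must lower the degree by 1. *)
Inductive homog : R -> expr -> Prop :=
| homog0 d : homog d (Cst N 0)
| homogC c : homog 0 (Cst N c)
| homogV i : homog 1 (Var R i)
| homogP b : homog (2 * b) (Pow N b)
| homogD d t u : homog d t -> homog d u -> homog d (Add t u)
| homogM d1 d2 t u : homog d1 t -> homog d2 u -> homog (d1 + d2) (Mul t u).

Lemma homog_deriv d t i : homog d t -> homog (d - 1) (deriv i t).
Proof.
elim => {d t} [d|c|j|b|d t u _ IHt _ IHu|d1 d2 t u ht IHt hu IHu] /=.
- exact: homog0.
- exact: homog0.
- by rewrite subrr; exact: homogC.
- rewrite (_ : 2 * b - 1 = 0 + (1 + 2 * (b - 1))); last by ring.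
  by apply: homogM; [exact: homogC|apply: homogM; [exact: homogV|exact: homogP]].
- exact: homogD.
- apply: homogD; first by rewrite addrAC; exact: homogM.
  by rewrite -addrA; exact: homogM.
Qed.

Lemma homog_derivs d t s : homog d t -> homog (d - (size s)%:R) (derivs s t).
Proof.
move=> dt; elim: s => [|i s IH] /=; first by rewrite subr0.
by rewrite -natr1 opprD addrA; exact: homog_deriv.
Qed.

(** Each coordinate is at most the square root of [rho e], and sums and products preserve such
    bounds; [C] does not depend on [e]. *)
Lemma homog_bound d t : homog d t -> exists2 C, 0 <= C &
  forall e x, 0 <= e -> 0 < rho e x -> `|eval t e x| <= C * rho e x `^ (d / 2).
Proof.
elim => {d t} [d|c|j|b|d t u _ [C C0 ht] _ [D D0 hu]
              |d1 d2 t u _ [C C0 ht] _ [D D0 hu]].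
- by exists 0 => // e x _ _; rewrite normr0 mul0r.
- by exists `|c| => // e x _ _; rewrite mul0r powRr0 mulr1.
- exists 1 => // e x e0 x0; rewrite mul1r mul1r powR12_sqrt ?(ltW x0)//=.
  rewrite -sqrtr_sqr ler_sqrt; last exact: ltW.
  rewrite /rho (bigD1 j)//= -addrA. rewrite lerDl.
  by rewrite addr_ge0// sumr_ge0// => i _; rewrite sqr_ge0.
- exists 1 => // e x _ x0; rewrite mul1r /= ger0_norm ?powR_ge0//.
  by rewrite mulrAC mulfV ?mul1r.
- exists (C + D) => [|e x e0 x0]; first exact: addr_ge0.
  by rewrite /= (le_trans (ler_normD _ _))// mulrDl lerD// ?ht ?hu.
- exists (C * D) => [|e x e0 x0]; first exact: mulr_ge0.
  have rx : rho e x != 0 by rewrite gt_eqF.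
  rewrite /= normrM mulrDl powRD ?rx ?implybT// mulrACA.
  by apply: ler_pM => //; [exact: ht|exact: hu].
Qed.

Lemma rhoDe e (x : E) : rho e x = rho 0 x + e.
Proof. by rewrite /rho addr0. Qed.

Lemma cvg_eval (t : expr) x : x != 0 ->
  eval t (harmonic n) x @[n --> \oo] --> eval t 0 x.
Proof.
move=> x0; elim: t => [c|i|b|t IHt u IHu|t IHt u IHu] /=.
- exact: cvg_cst.
- exact: cvg_cst.
- under eq_fun do rewrite rhoDe; apply: cvg_powR_harmonic.
  by rewrite rho0_gt0.
- exact: cvgD.
- exact: cvgM.
Qed.

Lemma measurable_rho e : measurable_fun [set: E] (rho e).
Proof.
apply: measurable_funD; last exact: measurable_cst.
by apply: measurable_sum => i; apply: measurable_funX; exact: measurable_coord.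
Qed.

Lemma measurable_eval (t : expr) e : measurable_fun [set: E] (eval t e).
Proof.
elim: t => [c|i|b|t IHt u IHu|t IHt u IHu] /=.
- exact: measurable_cst.
- exact: measurable_coord.
- by apply: (measurableT_comp (measurable_powR b)); exact: measurable_rho.
- exact: measurable_funD.
- exact: measurable_funM.
Qed.

Lemma continuous_eval (t : expr) e : 0 < e -> continuous (eval t e).
Proof.
by move=> e0 x; apply: differentiable_continuous; exact/differentiable_eval/rho_gt0.
Qed.

(* On the complement of the coordinate hyperplanes, [|x|^d] with [d <= 0] is at
   most the product of the [|x_i|^(d/N)]. *)
Lemma integral_rho_cube_lty (d M : R) : (0 < N)%N -> 0 < M -> - N%:R < d -> d <= 0 ->
  (\int[lebesgue_rV R N]_(x in cube M) (rho 0 x `^ (d / 2))%:E < +oo)%E.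
Proof.
(* [|x|^d] is the product of [N] copies of [(rho 0 x)^b], and [d > -N] becomes the one-dimensional
   condition [b > -1/2]. *)
move=> N0 M0 Nd d0; pose b := d / (2 * N%:R).
have N0' : 0 < N%:R :> R by rewrite ltr0n.
have b0 : b <= 0 by rewrite /b mulr_le0_ge0// invr_ge0 mulr_ge0// ltW.
have b2 : - 2^-1 < b.
  rewrite /b ltr_pdivlMr ?mulr_gt0//; move: Nd.
  by rewrite mulNr mulrA mulVf// mul1r.
pose f : R -> R := (fun t => (t * t) `^ b) \_ (punctured M).
have mtt : measurable_fun [set: measurableTypeR R]
    (fun t : measurableTypeR R => (t * t) `^ b).
  by apply: (measurableT_comp (measurable_powR b)); exact: measurable_funM.
have mf : measurable_fun setT f.
  apply/(measurable_restrictT _ (measurable_punctured M)).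
  exact: measurable_funTS.
have f0 t : 0 <= f t by rewrite /f patchE; case: ifP => // _; exact: powR_ge0.
have foo : (\int[lebesgue_measure]_t (f t)%:E < +oo)%E.
  have := integral_powR_lty M0 b2 b0; rewrite integral_mkcond.
  by rewrite (eq_integral (fun t : measurableTypeR R => (f t)%:E))// => t _;
    rewrite /f !patchE; case: ifP.
have := @integral_prod_coord_lty R f N mf f0 foo; apply: le_lt_trans.
rewrite integral_mkcond; apply: ae_ge0_le_integral => //.
- by move=> x _; rewrite patchE; case: ifP => // _; rewrite lee_fin powR_ge0.
- apply/(measurable_restrictT _ (cube_measurable M)).
  apply: measurable_funTS; apply/measurable_EFinP.
  by apply: (measurableT_comp (measurable_powR _)); exact: measurable_rho.
- by move=> x _; rewrite lee_fin prodr_ge0.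
- apply/measurable_EFinP/measurable_prod => i _.
  by apply: (measurableT_comp mf); exact: measurable_coord.
apply: filterS (@ae_coord_neq0 R N) => x xi _.
rewrite patchE; case: ifPn => [|_]; last by rewrite lee_fin prodr_ge0.
rewrite inE => xM; rewrite lee_fin.
have x0 : x != 0.
  by apply/eqP => x0; have := xi (Ordinal N0); rewrite x0 mxE eqxx.
have rx : 0 < rho 0 x by rewrite rho0_gt0.
have -> : rho 0 x `^ (d / 2) = \prod_(i < N) rho 0 x `^ b.
  rewrite prodr_const card_ord -powR_mulrn ?powR_ge0// -powRrM; congr (_ `^ _).
  by rewrite /b; field; rewrite gt_eqF.
apply: ler_prod => i _; rewrite powR_ge0/= /f patchE ifT; last first.
  rewrite inE; split; first by rewrite /= in_itv/= -ler_norml; exact: xM.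
  by apply/eqP; exact: xi.
apply: le0_ger_powR => //.
  by rewrite -expr2 exprn_even_gt0//= xi.
rewrite /rho addr0 (bigD1 i)//= expr2 lerDl.
by rewrite sumr_ge0// => j _; rewrite sqr_ge0.
Qed.

Lemma ae_neq0 : (0 < N)%N -> {ae lebesgue_rV R N, forall x : E, x != 0}.
Proof.
move=> N0; apply: filterS (@ae_coord_neq0 R N) => x xi.
by apply/eqP => x0; have := xi (Ordinal N0); rewrite x0 mxE eqxx.
Qed.

(** One function dominates for all [e] in [0, 1]: the nonnegative part of the exponent gives a
    bounded factor on the cube, and the nonpositive part gives one that is largest at [e = 0]. *)
Lemma homog_dominated (t : expr) d M : (0 < N)%N -> 0 < M ->
  homog d t -> - N%:R < d ->
  exists2 g : E -> R, (lebesgue_rV R N).-integrable setT (EFin \o g) &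
    (forall x, 0 <= g x) /\
    forall e x, 0 <= e <= 1 -> x != 0 -> cube M x -> `|eval t e x| <= g x.
Proof.
move=> N0 M0 /homog_bound[C C0 hC] Nd.
(* [delta] is the nonpositive part of [d], and [A] bounds [rho e x] on the cube for [e <= 1]. *)
pose delta := Num.min d 0; pose A := N%:R * (M * M) + 1.
pose K := C * A `^ ((d - delta) / 2).
have K0 : 0 <= K by rewrite mulr_ge0// powR_ge0.
have delta0 : delta <= 0 by rewrite ge_min lexx orbT.
have Ndelta : - N%:R < delta by rewrite lt_min Nd oppr_lt0 ltr0n.
pose g : E -> R := (fun x => K * rho 0 x `^ (delta / 2)) \_ (cube M).
have mg : measurable_fun [set: E] g.
  apply/(measurable_restrictT _ (cube_measurable M)).
  apply: measurable_funTS; apply: measurable_funM; first exact: measurable_cst.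
  by apply: (measurableT_comp (measurable_powR _)); exact: measurable_rho.
have g0 x : 0 <= g x.
  by rewrite /g patchE; case: ifP => // _; rewrite mulr_ge0 ?powR_ge0.
exists g.
  apply/integrableP; split; first exact/measurable_EFinP.
  rewrite (eq_integral ((fun x => K%:E * (rho 0 x `^ (delta / 2))%:E)%E \_ (cube M))).
    rewrite -integral_mkcond ge0_integralZl//.
    - by rewrite lte_mul_pinfty// ?lee_fin// integral_rho_cube_lty.
    - exact: cube_measurable.
    - apply: measurable_funTS; apply/measurable_EFinP.
      by apply: (measurableT_comp (measurable_powR _)); exact: measurable_rho.
    - by move=> x _; rewrite lee_fin powR_ge0.
  move=> x _; rewrite /= ger0_norm// /g !patchE; case: ifP => // _.
split => // e x /andP[e0 e1] x0 xM; have r0 : 0 < rho 0 x by rewrite rho0_gt0.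
have re : 0 < rho e x by rewrite rhoDe ltr_pwDl.
apply: (le_trans (hC e x e0 re)).
rewrite /g patchE ifT ?inE// /K -mulrA ler_wpM2l//.
have -> : d / 2 = (d - delta) / 2 + delta / 2 by field.
rewrite powRD; last by rewrite (gt_eqF re) implybT.
apply: ler_pM; rewrite ?powR_ge0//; last first.
  apply: le0_ger_powR => //; last by rewrite (rhoDe e) lerDl.
  by rewrite mulr_le0_ge0// invr_ge0.
apply: ge0_ler_powR; rewrite ?nnegrE ?(ltW re)//.
- by rewrite divr_ge0// subr_ge0 ge_min lexx.
- by rewrite /A addr_ge0// mulr_ge0// mulr_ge0// ltW.
rewrite /rho /A lerD//.
apply: (@le_trans _ _ (\sum_(i < N) M * M)); last first.
  by rewrite sumr_const card_ord mulr_natl.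
apply: ler_sum => i _; rewrite -real_normK ?num_real// expr2.
by apply: ler_pM.
Qed.

End homogeneous.

(** * Passing to the limit *)

Section regularization.
Variables (R : realType) (N : nat).
Local Notation E := 'rV[R]_N.
Local Notation expr := (expr R N).
Implicit Types (t : expr) (f phi psi : E -> R).

(** The functions of the theorem are expressions only away from the origin; a multiple of the
    indicator of [{0}] makes up the difference. *)
Lemma measurable_eq_off0 f g : measurable_fun [set: E] g ->
  (forall x, x != 0 -> f x = g x) -> measurable_fun [set: E] f.
Proof.
move=> mg fg.
have -> : f = (fun x => g x + (f 0 - g 0) * \1_[set 0] x).
  apply/funext => x; rewrite indicE.
  have [->|x0] := eqVneq x 0; first by rewrite mem_set// mulr1; ring.
  by rewrite memNset ?mulr0 ?addr0 ?fg//; exact/eqP.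
apply: measurable_funD => //; apply: measurable_funM; first exact: measurable_cst.
apply: measurable_indic; apply: closed_measurable_rV.
by apply: accessible_closed_set1; apply: hausdorff_accessible; exact: norm_hausdorff.
Qed.

Lemma integrable_continuous_cube f M : continuous f ->
  (forall x, ~ cube M x -> f x = 0) -> (lebesgue_rV R N).-integrable setT (EFin \o f).
Proof.
move=> cf f0; have [C _ hC] := continuous_bounded_cube M cf.
exact: (integrable_bounded_cube (continuous_measurable_rV cf) hC f0).
Qed.

(** Unlike a bare compact support, the same [M] serves for all derivatives of [phi]. *)
Definition smooth_cube M phi := smooth phi /\ forall x, ~ cube M x -> phi x = 0.

Lemma test_function_cube phi : test_function phi ->
  exists2 M, 0 < M & smooth_cube M phi.
Proof.
move=> [sphi /compact_sub_cube[M M0 KM]]; exists M => //; split => // x Mx.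
apply/eqP/negP => /negP px; apply/Mx/KM/subset_closure.
exact: px.
Qed.

Lemma smooth_cube_partial M phi i : smooth_cube M phi -> smooth_cube M (partial i phi).
Proof.
move=> [sphi phi0]; split.
  by move=> s; have := sphi (rcons s i); rewrite /partials foldr_rcons.
by apply: derive_outside_closed => //; exact: cube_closed.
Qed.

Lemma smooth_cube_partials M phi s : smooth_cube M phi -> smooth_cube M (partials s phi).
Proof. by move=> h; elim: s => [//|i s IH] /=; exact: smooth_cube_partial. Qed.

(** For [e > 0] the product [eval t e * phi] has a continuous derivative along [i] and vanishes off
    the cube, so this derivative integrates to 0. *)
Lemma eval_ibp t e phi M i : 0 < e -> smooth_cube M phi ->
  \int[lebesgue_rV R N]_x (eval t e x * partial i phi x) =
  - \int[lebesgue_rV R N]_x (eval (deriv i t) e x * phi x).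
Proof.
move=> e0 sphi; have [sm phi0] := sphi; have [_ dphi0] := smooth_cube_partial i sphi.
have [cphi dphi] := sm [::]; have [cdphi _] := sm [:: i].
have dt x : derivable (eval t e) x (delta_mx 0 i).
  exact/diff_derivable/differentiable_eval/rho_gt0.
have hE : partial i (eval t e * phi) =
    (fun x => eval t e x * partial i phi x + eval (deriv i t) e x * phi x).
  apply/funext => x; rewrite /partial deriveM//.
  by rewrite derive_eval ?rho_gt0// /GRing.scale/= [in RHS](mulrC _ (phi x)).
have c1 : continuous (fun x => eval t e x * partial i phi x).
  by move=> x; apply: continuousM; [exact: (continuous_eval e0)|exact: cdphi].
have c2 : continuous (fun x => eval (deriv i t) e x * phi x).
  by move=> x; apply: continuousM; [exact: (continuous_eval e0)|exact: cphi].
have i1 : (lebesgue_rV R N).-integrable setT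
    (EFin \o (fun x => eval t e x * partial i phi x)).
  by apply: (integrable_continuous_cube (M := M) c1) => x Mx; rewrite dphi0 ?mulr0.
have i2 : (lebesgue_rV R N).-integrable setT
    (EFin \o (fun x => eval (deriv i t) e x * phi x)).
  by apply: (integrable_continuous_cube (M := M) c2) => x Mx; rewrite phi0 ?mulr0.
apply/eqP; rewrite -subr_eq0 opprK; apply/eqP.
rewrite -RintegralD// /Rintegral.
have dh x : derivable (eval t e * phi) x (delta_mx 0 i).
  by apply: derivableM; [exact: dt|exact: dphi].
have h0 x : ~ cube M x -> (eval t e * phi) x = 0.
  by move=> Mx; rewrite fctE phi0// mulr0.
have := @integral_partial_eq0 R N i (eval t e * phi) M dh.
by rewrite hE => /(_ (fun x => continuousD (c1 x) (c2 x)) h0) ->.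
Qed.

(** Derivatives move one at a time from the outside of [phi] to the outside of [t], which reverses
    their order. *)
Lemma eval_ibps t e phi M s : 0 < e -> smooth_cube M phi ->
  \int[lebesgue_rV R N]_x (eval t e x * partials (rev s) phi x) =
  (-1) ^+ size s * \int[lebesgue_rV R N]_x (eval (derivs s t) e x * phi x).
Proof.
move=> e0; elim: s phi => [|i s IH] phi sphi; first by rewrite expr0 mul1r.
rewrite rev_cons /partials foldr_rcons -/(partials _ _).
rewrite (IH _ (smooth_cube_partial i sphi)) (eval_ibp _ _ e0 sphi) /=.
by rewrite exprS mulrN mulN1r mulNr.
Qed.

(** Dominated convergence with the bound [C * g]. Allowing a merely measurable [psi] admits
    indicators of cubes besides test functions. *)
Lemma homog_cvg_integral t d f psi M C : (0 < N)%N -> 0 < M ->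
  homog d t -> - N%:R < d -> (forall x, x != 0 -> f x = eval t 0 x) ->
  measurable_fun [set: E] psi -> 0 <= C -> (forall x, cube M x -> `|psi x| <= C) ->
  (forall x, ~ cube M x -> psi x = 0) ->
  (lebesgue_rV R N).-integrable setT (EFin \o (fun x => f x * psi x)) /\
  \int[lebesgue_rV R N]_x (eval t (harmonic n) x * psi x) @[n --> \oo] -->
  \int[lebesgue_rV R N]_x (f x * psi x).
Proof.
move=> N0 M0 ht Nd ft mpsi C0 psiC psi0.
have mf : measurable_fun [set: E] f := measurable_eq_off0 (measurable_eval t 0) ft.
have [g gi [g0 hg]] := homog_dominated N0 M0 ht Nd.
pose h n (x : E) := (eval t (harmonic n) x * psi x)%:E.
have [] := @dominated_convergence _ _ _ (lebesgue_rV R N) setT measurableT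
  h (EFin \o (fun x => f x * psi x)) (fun x => C%:E * (EFin \o g) x)%E.
- move=> n; apply/measurable_EFinP; apply: measurable_funM => //.
  exact: measurable_eval.
- by apply/measurable_EFinP; exact: measurable_funM.
- apply: filterS (ae_neq0 R N0) => x x0 _; apply: cvg_EFin; first exact: nearW.
  by apply: cvgM; [rewrite ft//; exact: cvg_eval|exact: cvg_cst].
- exact: integrableZl.
- apply: filterS (ae_neq0 R N0) => x x0 n _; rewrite -EFinM lee_fin normrM.
  have [xM|xM] := pselect (cube M x); last first.
    by rewrite psi0// normr0 mulr0 mulr_ge0.
  rewrite mulrC ler_pM// ?psiC// hg// harmonic_ge0/=.
  by rewrite /harmonic/= invf_le1 ?ler1n.
move=> fi _ hcvg; split => //.
have := hcvg; rewrite -[X in _ --> X]fineK; last exact: integrable_fin_num.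
by move=> /fine_cvg.
Qed.

(** Apply [homog_cvg_integral] with [psi] the indicator of a cube containing [K]. *)
Lemma homog_loc_integrable t d f : (0 < N)%N -> homog d t -> - N%:R < d ->
  (forall x, x != 0 -> f x = eval t 0 x) -> loc_integrable f.
Proof.
move=> N0 ht Nd ft.
have mf : measurable_fun [set: E] f := measurable_eq_off0 (measurable_eval t 0) ft.
split => // K cK; have [M M0 KM] := compact_sub_cube cK.
have [] := @homog_cvg_integral t d f (\1_(cube M)) M 1 N0 M0 ht Nd ft _ ler01.
- by apply: measurable_indic; exact: cube_measurable.
- by move=> x _; rewrite indicE normr_nat lern1 leq_b1.
- by move=> x xM; rewrite indicE memNset.
move=> /integrableP[mfM fM] _; apply: le_lt_trans fM.
rewrite [leLHS]integral_mkcond; apply: ge0_le_integral => //.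
- by move=> x _; rewrite patchE; case: ifP.
- apply/(measurable_restrictT _ (compact_measurable_rV cK)).
  by apply: measurable_funTS; apply/measurable_EFinP/measurableT_comp.
- exact: measurableT_comp.
- move=> x _; rewrite patchE; case: ifPn => [|_]; last exact: abse_ge0.
  rewrite inE => Kx.
  by rewrite /= indicE mem_set ?mulr1//; exact: KM.
Qed.

Lemma distr_partialsE s (u : distr R N) phi :
  distr_partials s u phi = (-1) ^+ size s * u (partials (rev s) phi).
Proof.
elim: s phi => [|i s IH] phi /=; first by rewrite expr0 mul1r.
rewrite /distr_partial IH rev_cons /partials foldr_rcons exprS.
by rewrite mulN1r mulNr.
Qed.

(** Both sides are limits of the two sides of [eval_ibps]. The bound on the degree keeps the
    differentiated expression integrable near 0, so no mass appears at the origin. *)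
Lemma homog_distr_partials t d f s phi : (0 < N)%N -> homog d t ->
  - N%:R < d - (size s)%:R -> (forall x, x != 0 -> f x = eval t 0 x) ->
  test_function phi ->
  distr_partials s (distr_of f) phi =
  \int[lebesgue_rV R N]_x (eval (derivs s t) 0 x * phi x).
Proof.
move=> N0 ht Nd ft /test_function_cube[M M0 sphi].
rewrite distr_partialsE /distr_of.
have conv psi u du h : homog du u -> - N%:R < du ->
    (forall x, x != 0 -> h x = eval u 0 x) -> smooth_cube M psi ->
    \int[lebesgue_rV R N]_x (eval u (harmonic n) x * psi x) @[n --> \oo] -->
    \int[lebesgue_rV R N]_x (h x * psi x).
  move=> hu Ndu uh [spsi psi0]; have [cpsi _] := spsi [::].
  have [C C0 hC] := continuous_bounded_cube M cpsi.
  have := homog_cvg_integral N0 M0 hu Ndu uh (continuous_measurable_rV cpsi) C0 hC psi0.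
  by case.
have Nd' : - N%:R < d by apply: (lt_le_trans Nd); rewrite gerBl.
have c1 := conv _ _ _ _ ht Nd' ft (smooth_cube_partials (rev s) sphi).
have c2 := conv _ _ _ _ (homog_derivs s ht) Nd (fun _ _ => erefl) sphi.
have c3 : (-1) ^+ size s *
    \int[lebesgue_rV R N]_x (eval (derivs s t) (harmonic n) x * phi x) @[n --> \oo] -->
    (-1) ^+ size s * \int[lebesgue_rV R N]_x (eval (derivs s t) 0 x * phi x).
  by apply: cvgM; [exact: cvg_cst|exact: c2].
rewrite -[RHS](signrMK (size s)); congr (_ * _).
move: c1; under eq_fun do rewrite (eval_ibps _ _ (harmonic_gt0 _) sphi).
by move=> c1; exact: (cvg_unique _ c1 c3).
Qed.

End regularization.

(** * Sums over multi-indices, the value of lambda, sums of integrals *)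

Section tensors.
Variables (R : realType) (N : nat).
Local Notation E := 'rV[R]_N.

Lemma mem_words k (s : seq 'I_N) : (s \in words N k) = (size s == k).
Proof.
elim: k s => [|k IH] [|i s] //=.
  by apply/negP => /allpairsPdep[u [j [_ _]]].
rewrite eqSS -IH; apply/allpairsPdep/idP => [[u [j [uk _ [_ ->]]]]//|sk].
by exists s, i; rewrite sk mem_enum.
Qed.

Lemma uniq_words k : uniq (words N k).
Proof.
elim: k => [//|k IH] /=; apply: allpairs_uniq => //; first exact: enum_uniq.
by move=> [u i] [v j] _ _ /= [-> ->].
Qed.

Lemma sum_words k (F : seq 'I_N -> R) :
  \sum_(I : k.-tuple 'I_N) F I = \sum_(s <- words N k) F s.
Proof.
rewrite -(big_map val predT F); apply: perm_big; apply: uniq_perm.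
- by rewrite map_inj_uniq ?index_enum_uniq//; exact: val_inj.
- exact: uniq_words.
- move=> s; rewrite mem_words; apply/mapP/eqP => [[I _ ->]|sk].
    exact: size_tuple.
  by exists (Tuple (introT eqP sk)) => //; rewrite mem_index_enum.
Qed.

Lemma enorm_rho b (x : E) : enorm x `^ b = rho 0 x `^ (b / 2).
Proof.
rewrite /enorm -powR12_sqrt; last by rewrite sumr_ge0// => i _; rewrite sqr_ge0.
by rewrite -powRrM mulrC /rho addr0.
Qed.

(** The coefficient from [Bsum_Pow] has the defining property, and evaluation at one nonzero point,
    here (1, ..., 1), determines the constant. *)
Lemma lambdaE (s : R) k : (0 < N)%N -> lambda N s k = bc N k (s / 2) (s / 2).
Proof.
move=> N0.
have sqE (x : E) : x != 0 -> norm_nabla k (fun y => enorm y `^ s) x ^+ 2 =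
    bc N k (s / 2) (s / 2) * enorm x `^ (- 2 * (k%:R - s)).
  move=> x0; rewrite /norm_nabla sqr_sqrtr; last first.
    by rewrite sumr_ge0// => I _; rewrite sqr_ge0.
  rewrite (sum_words k (fun I => partials I _ x ^+ 2)).
  transitivity (eval (Bsum k (Pow N (s / 2)) (Pow N (s / 2))) 0 x).
    rewrite eval_Bsum; apply: eq_bigr => I _; rewrite -expr2; congr (_ ^+ 2).
    apply: partials_eval; last by rewrite rho0_gt0.
    by move=> y _; rewrite /= enorm_rho.
  rewrite Bsum_Pow//= enorm_rho; congr (_ * _ `^ _); by field.
pose x1 : E := const_mx 1.
have x10 : x1 != 0.
  apply/eqP => /rowP/(_ (Ordinal N0)); rewrite !mxE => /eqP; by rewrite oner_eq0.
have lE : norm_nabla k (fun y => enorm y `^ s) x1 ^+ 2 =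
    lambda N s k * enorm x1 `^ (- 2 * (k%:R - s)).
  (* The default of [xget] is excluded because [sqE] exhibits a suitable constant. *)
  by rewrite /lambda; case: xgetP => [l _ ->//|/(_ _ sqE)].
move: lE; rewrite sqE// => /esym.
apply: mulIf; rewrite powR_eq0 negb_and; apply/orP; left.
rewrite /enorm sqrtr_eq0 -ltNge -(addr0 (\sum_(i < N) _)) -/(rho 0 x1).
by rewrite rho0_gt0.
Qed.

(** Integrability is asked only of members of [r]: below, degrees are known only for words of length
    [k]. *)
Lemma Rintegral_sum d (T : measurableType d) (mu : {measure set T -> \bar R})
    (I : eqType) (r : seq I) (F : I -> T -> R) :
  (forall i, i \in r -> mu.-integrable setT (EFin \o F i)) ->
  mu.-integrable setT (EFin \o (fun x => \sum_(i <- r) F i x)) /\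
  \int[mu]_x (\sum_(i <- r) F i x) = \sum_(i <- r) \int[mu]_x F i x.
Proof.
elim: r => [_|i r IH h].
  have E : (fun x : T => \sum_(i <- [::]) F i x) = cst 0.
    by apply/funext => x; rewrite big_nil.
  rewrite E big_nil; split; first exact: integrable0.
  by rewrite /Rintegral integral0.
have [|IHi IHe] := IH; first by move=> j jr; apply: h; rewrite in_cons jr orbT.
have Fi := h i (mem_head _ _).
have E : (fun x : T => \sum_(j <- i :: r) F j x) =
    (fun x => F i x + \sum_(j <- r) F j x).
  by apply/funext => x; rewrite big_cons.
rewrite E; split.
  rewrite (_ : EFin \o _ = (EFin \o F i) \+ (EFin \o (fun x => \sum_(j <- r) F j x))).
    exact: integrableD.
  by apply/funext => x /=; rewrite EFinD.
by rewrite RintegralD// big_cons IHe.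
Qed.

End tensors.

(** * The identity in the sense of distributions *)

Theorem theorem3p2 (R : realType) (N : nat) (N_gt0 : (0 < N)%N)
    (k : nat) (k_gt0 : (0 < k)%N) (alpha : R) (k_lt_alpha : k%:R < alpha) :
  let T (I : k.-tuple 'I_N) (x : 'rV[R]_N) : R :=
    enorm x `^ (2 * alpha - N%:R)
      * partials I (fun y => (enorm y `^ (alpha - k%:R))^-1) x in
  let g (x : 'rV[R]_N) : R :=
    lambda N (k%:R - alpha) k / enorm x `^ (N%:R - alpha + k%:R) in
  [/\ forall I : k.-tuple 'I_N, loc_integrable (T I),
      loc_integrable g
    & distr_eq
        (fun phi => (-1) ^+ k * distr_div (fun I => distr_of (T I)) phi)
        (distr_of g)].
Proof.
move=> T g.
(* Half exponents: [rho 0 x] to the powers [m] and [a] is [|x|^(2 alpha - N)] and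
   [|x|^(k - alpha)]. *)
pose m : R := (2 * alpha - N%:R) / 2; pose a : R := (k%:R - alpha) / 2.
pose t (s : seq 'I_N) : expr R N := Mul (Pow N m) (derivs s (Pow N a)).
have TE (I : k.-tuple 'I_N) x : x != 0 -> T I x = eval (t I) 0 x.
  move=> x0; rewrite /T /t /= enorm_rho; congr (_ * _).
  apply: partials_eval; last by rewrite rho0_gt0.
  by move=> y _; rewrite /= enorm_rho -powRN -mulNr opprB.
have tH (s : seq 'I_N) : size s = k -> homog (alpha - N%:R) (t s).
  move=> sk; rewrite (_ : alpha - N%:R = 2 * m + (2 * a - (size s)%:R)).
    by apply: homogM; [exact: homogP|exact/homog_derivs/homogP].
  by rewrite sk /m /a; field.
have k0 : 0 < k%:R :> R by rewrite ltr0n.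
have gE x : x != 0 -> g x =
    eval (Mul (Cst N (bc N k a a)) (Pow N ((alpha - k%:R - N%:R) / 2))) 0 x.
  move=> x0; rewrite /g lambdaE// enorm_rho /= -powRN -mulNr.
  by rewrite (_ : - (N%:R - alpha + k%:R) = alpha - k%:R - N%:R)//; ring.
have gH : homog (alpha - k%:R - N%:R)
    (Mul (Cst N (bc N k a a)) (Pow N ((alpha - k%:R - N%:R) / 2))).
  rewrite [X in homog X _](_ : _ = 0 + 2 * ((alpha - k%:R - N%:R) / 2)).
    by apply: homogM; [exact: homogC|exact: homogP].
  by field.
(* The tensor has degree [alpha - N]; after [k] more derivatives the degree is [alpha - k - N],
   above [-N] exactly because [alpha > k]. *)
have Nd1 : - N%:R < alpha - N%:R by move: k0 k_lt_alpha; lra.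
have Nd2 : - N%:R < alpha - k%:R - N%:R by move: k0 k_lt_alpha; lra.
have Nd3 : - N%:R < alpha - N%:R - k%:R by move: k0 k_lt_alpha; lra.
split.
- move=> I; apply: (homog_loc_integrable N_gt0 (tH I (size_tuple I)) Nd1).
  by move=> x x0; exact: TE.
- exact: (homog_loc_integrable N_gt0 gH Nd2 gE).
move=> phi tphi; rewrite /distr_div.
rewrite (eq_bigr (fun I : k.-tuple 'I_N =>
    \int[lebesgue_rV R N]_x (eval (derivs I (t I)) 0 x * phi x))); last first.
  move=> I _; apply: (homog_distr_partials N_gt0 (tH I (size_tuple I))) => //.
  - by rewrite size_tuple.
  - by move=> x x0; exact: TE.
rewrite (sum_words k (fun I =>
  \int[lebesgue_rV R N]_x (eval (derivs I (t I)) 0 x * phi x))).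
have [M M0 [sphi phi0]] := test_function_cube tphi.
have [cphi _] := sphi [::].
have [C C0 hC] := continuous_bounded_cube M cphi.
have intI s : s \in words N k -> (lebesgue_rV R N).-integrable setT
    (EFin \o (fun x => eval (derivs s (t s)) 0 x * phi x)).
  rewrite mem_words => /eqP sk.
  have hs := homog_derivs s (tH s sk); rewrite sk in hs.
  by have [] := homog_cvg_integral N_gt0 M0 hs Nd3 (fun _ _ => erefl)
    (continuous_measurable_rV cphi) C0 hC phi0.
have [sumi <-] := Rintegral_sum intI.
rewrite -RintegralZl// /distr_of /Rintegral; congr fine.
have mg := measurable_eq_off0 (measurable_eval _ 0) gE.
(* The integrands are compared off the origin, which is a null set since [N > 0]. *)
apply: ae_eq_integral => //.
- apply/measurable_EFinP; apply: measurable_funM; first exact: measurable_cst.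
  by apply/measurable_EFinP; have /integrableP[] := sumi.
- apply/measurable_EFinP; apply: measurable_funM => //.
  exact: continuous_measurable_rV.
apply: filterS (ae_neq0 R N_gt0) => x x0 _; congr EFin.
rewrite gE// -mulr_suml mulrA; congr (_ * _).
rewrite -(eval_Dsum k (Pow N m) (Pow N a)) Dsum_Pow//= mulrA.
(* Here [b = a], and [m + 2 a = k - N / 2] as required. *)
rewrite (@dc_bc _ _ _ _ _ a); last by rewrite /m /a; field.
by congr (_ * _ `^ _); rewrite /m /a; field.
Qed.
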